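(* Let $d>0$ be a fixed integer. As $b\to\infty$ through the integers $b>d$, the quantity $I(b,d,0)-\bigl(b\log(b)-b\log(1+d^{-1})\bigr)$ has an asymptotic expansion to all orders in inverse powers of $b$. It starts with $$I(b,d,0)=b\log(b)-b\log\Bigl(1+\frac1d\Bigr)+\frac{a_1(d)}{b}+\frac{a_2(d)}{b^2}+\frac{a_3(d)}{b^3}+\frac{a_4(d)}{b^4}+\frac{a_5(d)}{b^5}+O(b^{-6}),$$ with (implicit constant depending on $d$): \begin{align*} a_1(d)={}&(d+\tfrac12)(\zeta(2)-d^{-2}),\\ a_2(d)={}&-(d^2+d+\tfrac13)\zeta(3)+\frac{9d^2+8d+2}{6d^3(d+1)},\\ a_3(d)={}&(d+\tfrac12)(d^2+d+\tfrac12)\zeta(4)-(d+\tfrac12)\zeta(2)-(d+\tfrac12)\frac{2d^4+6d^3+6d^2+4d+1}{2d^4(d+1)^2},\\ a_4(d)={}&-(d^4+2d^3+2d^2+d+\tfrac15)\zeta(5)+(2d+1)d\,\zeta(3)-(d+\tfrac12)\zeta(2)\\ &+\frac{60d^7+240d^6+500d^5+705d^4+627d^3+331d^2+96d+12}{60d^5(d+1)^3},\\ a_5(d)={}&(d+\tfrac12)(d^2+d+1)(d^2+d+\tfrac13)\zeta(6)-3(d+\tfrac12)d^2\zeta(4)+(3d^2+3d+\tfrac56)\zeta(3)\\ &-(d+\tfrac12)\frac{9d^6+38d^5+56d^4+44d^3+22d^2+7d+1}{3d^6(d+1)^3}. \end{align*}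
   Context: For integers $b\ge 2$ and $0\le d<b$, $I(b,d,0)=K(b,d)=\sum' \frac1m$, where the sum runs over all integers $m>0$ whose base-$b$ representation (without leading zeros) does not contain the digit $d$ (this series converges). $\zeta$ is the Riemann zeta function. A function $f$ of the integer $b$ has an asymptotic expansion to all orders in inverse powers of $b$ if there are coefficients $a_n$ independent of $b$ (but depending on $d$) such that for every $N$, $f(b)=\sum_{n\le N}a_nb^{-n}+O(b^{-N-1})$ as $b\to\infty$. *)

(* Defs.v *)
From HB Require Import structures.
From mathcomp Require Import all_boot all_order all_algebra.
From mathcomp Require Import all_classical all_reals all_analysis.

Set Implicit Arguments.
Unset Strict Implicit.
Unset Printing Implicit Defensive.

Import Order.TTheory GRing.Theory Num.Theory.
Import numFieldNormedType.Exports.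

Local Open Scope classical_set_scope.
Local Open Scope ring_scope.

(* The i-th digit of m is (m %/ b ^ i) %% b; the guard b ^ i <= m selects the
   positions actually present when m is written without leading zeros, so that
   the definition is also the right one for d = 0. *)
Definition digit_free (b d m : nat) : Prop :=
  forall i : nat, (b ^ i <= m)%N -> ((m %/ b ^ i) %% b)%N <> d.

(* The sum is taken in \bar R; [fine] would send a divergent sum to 0. *)
Definition kempner (R : realType) (b d : nat) : R :=
  fine (\esum_(m in [set m : nat | (0 < m)%N /\ digit_free b d m])
          (m%:R^-1 : R)%:E).

(* The Dirichlet series: this is the Riemann zeta function only for 1 < s. *)
Definition zeta (R : realType) (s : R) : R := limn (series (riemannR s)).

Definition has_asymptotic_expansion (R : realType) (f : nat -> R) : Prop :=
  exists a : nat -> R, forall N : nat,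
    f = (fun b : nat => \sum_(0 <= n < N.+1) a n * b%:R ^- n)
        +O_\oo (fun b : nat => b%:R ^- N.+1 : R).

Definition kempner_coef1 (R : realType) (d : R) : R :=
  (d + 1 / 2) * (zeta 2 - d ^- 2).

Definition kempner_coef2 (R : realType) (d : R) : R :=
  - (d ^+ 2 + d + 1 / 3) * zeta 3
  + (9 * d ^+ 2 + 8 * d + 2) / (6 * d ^+ 3 * (d + 1)).

Definition kempner_coef3 (R : realType) (d : R) : R :=
  (d + 1 / 2) * (d ^+ 2 + d + 1 / 2) * zeta 4
  - (d + 1 / 2) * zeta 2
  - (d + 1 / 2) * ((2 * d ^+ 4 + 6 * d ^+ 3 + 6 * d ^+ 2 + 4 * d + 1)
                   / (2 * d ^+ 4 * (d + 1) ^+ 2)).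

Definition kempner_coef4 (R : realType) (d : R) : R :=
  - (d ^+ 4 + 2 * d ^+ 3 + 2 * d ^+ 2 + d + 1 / 5) * zeta 5
  + (2 * d + 1) * d * zeta 3
  - (d + 1 / 2) * zeta 2
  + (60 * d ^+ 7 + 240 * d ^+ 6 + 500 * d ^+ 5 + 705 * d ^+ 4
     + 627 * d ^+ 3 + 331 * d ^+ 2 + 96 * d + 12)
    / (60 * d ^+ 5 * (d + 1) ^+ 3).

Definition kempner_coef5 (R : realType) (d : R) : R :=
  (d + 1 / 2) * (d ^+ 2 + d + 1) * (d ^+ 2 + d + 1 / 3) * zeta 6
  - 3 * (d + 1 / 2) * d ^+ 2 * zeta 4
  + (3 * d ^+ 2 + 3 * d + 5 / 6) * zeta 3
  - (d + 1 / 2) * ((9 * d ^+ 6 + 38 * d ^+ 5 + 56 * d ^+ 4 + 44 * d ^+ 3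
                    + 22 * d ^+ 2 + 7 * d + 1)
                   / (3 * d ^+ 6 * (d + 1) ^+ 3)).

(* Main.v *)
Require Import Defs.
From HB Require Import structures.
From mathcomp Require Import all_boot all_order all_algebra.
From mathcomp Require Import all_classical all_reals all_analysis.
From mathcomp Require Import ring lra.

Set Implicit Arguments.
Unset Strict Implicit.
Unset Printing Implicit Defensive.

Import Order.TTheory GRing.Theory Num.Theory.
Import numFieldNormedType.Exports.

Local Open Scope classical_set_scope.
Local Open Scope ring_scope.

(** Write t = 1/b. For a function f on [0,1] let T f (x) be the average
    t * (f(x/b) + f((1+x)/b) + ... + f((b-1+x)/b)), and let T' f be the same sum
    without the term of the digit d. The digit-free integers with l + 1 digits
    contribute W_l(0) to the series, where W_l(x) is the sum of 1/(m+x) over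
    these integers m; removing the last digit gives W_(l+1) = T' W_l. Hence
    K(b,d) = b M(W_0), where the linear functional M f = t * sum_l (T'^l f)(0)
    satisfies M 1 = 1, |M f| <= sup |f| and the fixed-point equation
      M f = t f(0) + M(T f) - t M(f((d+.)/b))                 ([mean_eq]).

    The function phi(x) = sum_(n>=1) (1/n - 1/(n+x)) (the digamma function at
    1 + x, up to a constant) satisfies T phi - phi = sum_(1<=n<b) 1/(n+x) - log b
    ([avg_digam]), and W_0 is this sum minus 1/(d+x). Thus, exactly,
      K(b,d) = b log b - b M(1/(d+x)) + M(phi((d+x)/b))       ([kempner_digam]).
    The Taylor coefficients of phi at 0 are the zeta values, so the last term
    expands in powers of t with coefficients involving the moments
    V_j = M((d+x)^j). The middle term is transformed by the fixed-point equation
    into G_1 and a similar Taylor expansion, where G_s = M(T (d+x)^(-s)).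

    Summing F(w + t) - F(w) over the points w = (a+x)/b, 0 <= a < b, telescopes.
    With F(w) = w^(j+1) this gives, together with the fixed-point equation for
    x^j, linear recurrences for the moments U_j = M(x^j) and E_j = M(T x^j)
    ([momE_rec], [momU_recE]); with
    F(w) = (d+w)^(-s) and F(w) = log(d+w) it gives relations between the G_s and
    the U_j with errors O(t^J) for every J ([momG_rel], [momG_log_rel]). In all of
    them each unknown is expressed through known terms and through unknowns
    multiplied by positive powers of t, so that expansions to order n yield
    expansions to order n + 1 ([has_expansion_moments], [has_expansion_momG]).
    This proves the existence of an expansion to all orders
    ([has_expansion_kempner_corr]).

    As coefficients are unique ([expands_unique]), the same relations become
    linear equations between coefficients, which are solved explicitly to the
    order needed for the five displayed terms ([kempner_corr_coefs]). *)

(** * Averages over digits and the associated mean *)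

Section mean.
Variables (R : realType) (b d : nat).
Implicit Types (f g : R -> R) (c x : R).

(** Boundedness on [0,1]. Functions are total on the reals, but only their
    values on [0,1] matter below. *)
Definition bounded01 f := exists c, forall x, 0 <= x <= 1 -> `|f x| <= c.

(** The average over the digits a <> d of f((a+x)/b), still divided by b
    although only b - 1 digits occur. *)
Definition digit_avg f x : R :=
  b%:R^-1 * \sum_(a < b | a != d :> nat) f ((a%:R + x) / b%:R).

(** The same average over all the digits; it preserves constants. *)
Definition avg f x : R := b%:R^-1 * \sum_(a < b) f ((a%:R + x) / b%:R).

(** The normalised mean M f. Each string of l digits avoiding d, l >= 0, read
    after the radix point in base b, is a point of [0,1] and receives the
    weight t * t^l; the total weight is 1. *)
Definition mean f : R :=
  b%:R^-1 * limn (series (fun l => iter l digit_avg f 0)).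

Lemma bounded01_lin f g c : bounded01 f -> bounded01 g ->
  bounded01 (fun x => f x + c * g x).
Proof.
move=> [cf Hf] [cg Hg]; exists (cf + `|c| * cg) => x x01.
by rewrite (le_trans (ler_normD _ _))// lerD ?Hf// normrM ler_wpM2l ?Hg.
Qed.

Lemma bounded01_cst c : bounded01 (fun=> c).
Proof. by exists `|c|. Qed.

Lemma bounded01Z f c : bounded01 f -> bounded01 (fun x => c * f x).
Proof.
move=> /(bounded01_lin c (bounded01_cst 0)).
by congr bounded01; apply/funext => x; rewrite add0r.
Qed.

Lemma bounded01D f g : bounded01 f -> bounded01 g ->
  bounded01 (fun x => f x + g x).
Proof.
move=> bf /(bounded01_lin 1 bf).
by congr bounded01; apply/funext => x; rewrite mul1r.
Qed.

Lemma bounded01B f g : bounded01 f -> bounded01 g ->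
  bounded01 (fun x => f x - g x).
Proof.
move=> bf /(bounded01_lin (-1) bf).
by congr bounded01; apply/funext => x; rewrite mulN1r.
Qed.

Lemma bounded01_sum n (F : nat -> R -> R) :
  (forall i, (i < n)%N -> bounded01 (F i)) ->
  bounded01 (fun x => \sum_(i < n) F i x).
Proof.
elim: n => [|n IH] HF.
  by exists 0 => x _; rewrite big_ord0 normr0.
have [c1 H1] := IH (fun i Hi => HF i (ltnW Hi)).
have [c2 H2] := HF n (ltnSn n).
exists (c1 + c2) => x x01; rewrite big_ord_recr/=.
by rewrite (le_trans (ler_normD _ _))// lerD ?H1 ?H2.
Qed.

Lemma digit_avg_lin f g c x :
  digit_avg (fun x => f x + c * g x) x = digit_avg f x + c * digit_avg g x.
Proof. by rewrite /digit_avg big_split/= [LHS]mulrDr [c * _]mulrCA [c * _]mulr_sumr. Qed.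

Lemma iter_digit_avg_lin f g c l x :
  iter l digit_avg (fun x => f x + c * g x) x
  = iter l digit_avg f x + c * iter l digit_avg g x.
Proof.
elim: l x => // l IH x; rewrite !iterS -digit_avg_lin.
by congr (digit_avg _ x); apply/funext.
Qed.

Hypothesis lt_db : (d < b)%N.

Let b_gt0 : 0 < b%:R :> R.
Proof. by rewrite ltr0n (leq_trans _ lt_db). Qed.

Lemma digit01 a x : (a < b)%N -> 0 <= x <= 1 -> 0 <= (a%:R + x) / b%:R <= 1.
Proof.
move=> ab /andP[x0 x1]; rewrite divr_ge0 ?addr_ge0 ?(ltW b_gt0)//=.
rewrite ler_pdivrMr// mul1r.
have : (a.+1%:R <= b%:R :> R) by rewrite ler_nat.
by rewrite -natr1; lra.
Qed.

Lemma digit_avgE f x :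
  digit_avg f x = avg f x - b%:R^-1 * f ((d%:R + x) / b%:R).
Proof.
rewrite /digit_avg /avg [in RHS](bigD1 (Ordinal lt_db))//= [b%:R^-1 * (_ + _)]mulrDr.
rewrite [X in X - _]addrC addrK.
by congr (_ * _); apply: eq_bigl => i; rewrite -val_eqE.
Qed.

Lemma digit_avg_cst c x : digit_avg (fun=> c) x = (1 - b%:R^-1) * c.
Proof.
rewrite digit_avgE /avg sumr_const card_ord -[X in _ * X]mulr_natl.
by rewrite mulrA mulVf ?gt_eqF// mulrBl.
Qed.

Lemma norm_avg_le f c : (forall x, 0 <= x <= 1 -> `|f x| <= c) ->
  forall x, 0 <= x <= 1 -> `|avg f x| <= c.
Proof.
move=> Hc x x01; rewrite /avg normrM gtr0_norm ?invr_gt0//.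
rewrite ler_pdivrMl// (le_trans (ler_norm_sum _ _ _))//.
rewrite (@le_trans _ _ (\sum_(i < b) c))//.
  by apply: ler_sum => i _; apply: Hc; apply: digit01.
by rewrite sumr_const card_ord mulr_natl.
Qed.

Lemma bounded01_avg f : bounded01 f -> bounded01 (avg f).
Proof. by move=> [c Hc]; exists c; exact: norm_avg_le. Qed.

Lemma le_digit_avg f g : (forall x, 0 <= x <= 1 -> f x <= g x) ->
  forall x, 0 <= x <= 1 -> digit_avg f x <= digit_avg g x.
Proof.
move=> fg x x01; rewrite /digit_avg ler_wpM2l ?invr_ge0 ?(ltW b_gt0)//.
by apply: ler_sum => i _; apply: fg; apply: digit01.
Qed.

Lemma le_iter_digit_avg f g l : (forall x, 0 <= x <= 1 -> f x <= g x) ->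
  forall x, 0 <= x <= 1 -> iter l digit_avg f x <= iter l digit_avg g x.
Proof.
move=> fg; elim: l => // l IH x x01; rewrite !iterS; exact: le_digit_avg.
Qed.

Lemma iter_digit_avg_cst c l x :
  iter l digit_avg (fun=> c) x = c * (1 - b%:R^-1) ^+ l.
Proof.
elim: l x => [x|l IH x]; first by rewrite mulr1.
rewrite iterS (_ : iter _ _ _ = fun=> c * (1 - b%:R^-1) ^+ l); last exact/funext.
by rewrite digit_avg_cst exprS mulrCA.
Qed.

Let ratio : `|1 - b%:R^-1 : R| < 1.
Proof.
have : b%:R^-1 <= 1 :> R by rewrite invf_le1// ler1n (leq_trans _ lt_db).
have : 0 < b%:R^-1 :> R by rewrite invr_gt0.
by move=> h1 h2; rewrite ger0_norm; lra.
Qed.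

Let zero01 : 0 <= (0 : R) <= 1. Proof. by rewrite lexx ler01. Qed.

Lemma cvg_digit_avg_series f : bounded01 f ->
  cvgn (series (fun l => iter l digit_avg f 0)).
Proof.
move=> [c Hc]; apply: normed_cvg.
apply: (@series_le_cvg _ _ (geometric c (1 - b%:R^-1))) => //.
- by move=> n /=; exact: normr_ge0.
- move=> n /=; rewrite mulr_ge0//.
    by apply: le_trans (normr_ge0 (f 0)) (Hc 0 _).
  by rewrite exprn_ge0// subr_ge0 invf_le1// ler1n (leq_trans _ lt_db).
- move=> n /=; rewrite -(iter_digit_avg_cst c n 0) ler_norml; apply/andP; split.
    rewrite -[leLHS]mulN1r.
    rewrite iter_digit_avg_cst mulN1r -mulNr -(iter_digit_avg_cst (-c) n 0).
    apply: le_iter_digit_avg => // x x01.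
    by rewrite lerNl (le_trans (ler_norm _))// normrN Hc.
  apply: le_iter_digit_avg => // x x01.
  by rewrite (le_trans (ler_norm _))// Hc.
- exact: is_cvg_geometric_series.
Qed.

Lemma mean_lin f g c : bounded01 f -> bounded01 g ->
  mean (fun x => f x + c * g x) = mean f + c * mean g.
Proof.
move=> /cvg_digit_avg_series bf /cvg_digit_avg_series bg.
rewrite /mean mulrCA -mulrDr; congr (_ * _).
apply/cvg_lim => //.
rewrite (_ : series _ = (fun n => series (fun l => iter l digit_avg f 0) n
    + c * series (fun l => iter l digit_avg g 0) n)); last first.
  apply/funext => n; rewrite /series/= mulr_sumr -big_split/=.
  by apply: eq_bigr => i _; rewrite iter_digit_avg_lin.
by apply: cvgD => //; apply: cvgM => //; exact: cvg_cst.
Qed.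

Lemma le_mean f g : bounded01 f -> bounded01 g ->
  (forall x, 0 <= x <= 1 -> f x <= g x) -> mean f <= mean g.
Proof.
move=> bf bg fg; rewrite /mean ler_wpM2l ?invr_ge0 ?(ltW b_gt0)//.
apply: lim_series_le; [exact: cvg_digit_avg_series..|].
by move=> n; apply: le_iter_digit_avg.
Qed.

Lemma eq_mean f g : bounded01 f ->
  (forall x, 0 <= x <= 1 -> f x = g x) -> mean f = mean g.
Proof.
move=> bf fg.
have bg : bounded01 g.
  by case: bf => c Hc; exists c => x x01; rewrite -fg// Hc.
by apply/eqP; rewrite eq_le !le_mean// => x /fg->.
Qed.

Lemma mean_cst c : mean (fun=> c) = c.
Proof.
rewrite /mean; set s := series _.
have -> : s = series (geometric c (1 - b%:R^-1)).
  by congr (series _); apply/funext => l; rewrite iter_digit_avg_cst.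
rewrite (cvg_lim _ (cvg_geometric_series _))//.
by rewrite subKr invrK mulrC mulfK// gt_eqF.
Qed.

Lemma meanZ f c : bounded01 f -> mean (fun x => c * f x) = c * mean f.
Proof.
move=> bf; rewrite -[RHS]add0r -[X in X + _](mean_cst 0).
rewrite -mean_lin//; last exact: bounded01_cst.
by congr mean; apply/funext => x; rewrite add0r.
Qed.

Lemma meanD f g : bounded01 f -> bounded01 g ->
  mean (fun x => f x + g x) = mean f + mean g.
Proof.
move=> bf bg; rewrite -[mean g]mul1r -mean_lin//.
by congr mean; apply/funext => x; rewrite mul1r.
Qed.

Lemma meanB f g : bounded01 f -> bounded01 g ->
  mean (fun x => f x - g x) = mean f - mean g.
Proof.
move=> bf bg; rewrite -[mean g]mul1r -mulNr -mean_lin//.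
by congr mean; apply/funext => x; rewrite mulN1r.
Qed.

Lemma mean_sum n (F : nat -> R -> R) :
  (forall i, (i < n)%N -> bounded01 (F i)) ->
  mean (fun x => \sum_(i < n) F i x) = \sum_(i < n) mean (F i).
Proof.
elim: n => [|n IH] HF.
  rewrite big_ord0 -[RHS](mean_cst 0); congr mean.
  by apply/funext => x; rewrite big_ord0.
rewrite big_ord_recr/= -IH; last by move=> i Hi; apply: HF; exact: ltnW.
rewrite -meanD; last 2 first.
- by apply: bounded01_sum => i Hi; apply: HF; exact: ltnW.
- exact: HF.
by congr mean; apply/funext => x; rewrite big_ord_recr.
Qed.

Lemma norm_mean_le f c : (forall x, 0 <= x <= 1 -> `|f x| <= c) ->
  `|mean f| <= c.
Proof.
move=> Hc; have bf : bounded01 f by exists c.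
rewrite ler_norml -{1}(mean_cst (- c)) -{2}(mean_cst c).
apply/andP; split; apply: le_mean => //; try exact: bounded01_cst.
  by move=> x /Hc; rewrite ler_norml => /andP[].
by move=> x /Hc; rewrite ler_norml => /andP[].
Qed.

Lemma mean_digit_avg f : bounded01 f ->
  mean f = b%:R^-1 * f 0 + mean (digit_avg f).
Proof.
move=> bf; rewrite /mean -mulrDr; congr (_ * _).
apply/cvg_lim => //; rewrite -cvg_shiftS.
rewrite (_ : [sequence _]_n = (fun n => f 0 +
    series (fun l => iter l digit_avg (digit_avg f) 0) n)); last first.
  apply/funext => n; rewrite /series/= big_nat_recl//=.
  by congr (_ + _); apply: eq_bigr => i _; rewrite -iterS iterSr.
apply: cvgD; first exact: cvg_cst.
apply: cvg_digit_avg_series.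
have bfd : bounded01 (fun x => f ((d%:R + x) / b%:R)).
  by case: bf => c Hc; exists c => x x01; rewrite Hc// digit01.
have := bounded01B (bounded01_avg bf) (bounded01Z b%:R^-1 bfd).
by congr bounded01; apply/funext => x; rewrite digit_avgE.
Qed.

(** The fixed-point equation: the term l = 0 is split off, and the missing
    digit d is restored in the others. *)
Lemma mean_eq f : bounded01 f ->
  mean f = b%:R^-1 * f 0 + mean (avg f)
           - b%:R^-1 * mean (fun x => f ((d%:R + x) / b%:R)).
Proof.
move=> bf; rewrite {1}mean_digit_avg// -addrA; congr (_ + _).
have bfd : bounded01 (fun x => f ((d%:R + x) / b%:R)).
  by case: bf => c Hc; exists c => x x01; rewrite Hc// digit01.
have ba := bounded01_avg bf.
rewrite -mulNr -mean_lin//; congr mean; apply/funext => x.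
by rewrite digit_avgE mulNr.
Qed.

End mean.

(** * The Kempner sum as a mean *)

Lemma sum_nat_digit (V : zmodType) (F : nat -> V) (b m n : nat) : (m <= n)%N ->
  \sum_(m * b <= j < n * b) F j = \sum_(m <= i < n) \sum_(a < b) F (i * b + a)%N.
Proof.
elim: n => [|n IH] mn.
  by move: mn; rewrite leqn0 => /eqP ->; rewrite !big_geq.
move: mn; rewrite leq_eqVlt ltnS => /predU1P[->|mn]; first by rewrite !big_geq.
rewrite (@big_cat_nat _ _ _ (n * b))/= ?leq_mul2r ?leqnSn ?mn ?orbT//.
rewrite big_nat_recr//= -IH//; congr (_ + _).
rewrite -{1}[(n * b)%N]add0n big_addn mulSn addnK big_mkord.
by apply: eq_bigr => a _; rewrite addnC.
Qed.

Lemma digit_free_lt b d m : (0 < m < b)%N -> digit_free b d m <-> m <> d.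
Proof.
move=> /andP[m0 mb]; split => [/(_ 0%N)|md i].
  by rewrite expn0 divn1 modn_small//; apply.
case: i => [|i]; first by rewrite expn0 divn1 modn_small.
move=> bm; have : (b <= m)%N.
  apply: leq_trans bm; rewrite expnS leq_pmulr// expn_gt0.
  by rewrite (leq_trans _ mb).
by rewrite leqNgt mb.
Qed.

(** Appending a last digit a to a positive integer m. *)
Lemma digit_free_rcons b d m a : (0 < m)%N -> (a < b)%N ->
  digit_free b d (m * b + a) <-> digit_free b d m /\ a <> d.
Proof.
move=> m0 ab; have b0 : (0 < b)%N by rewrite (leq_trans _ ab).
have digitS i : ((m * b + a) %/ b ^ i.+1 = m %/ b ^ i)%N.
  by rewrite expnS divnMA divnMDl// (divn_small ab) addn0.
have leS i : (b ^ i.+1 <= m * b + a)%N = (b ^ i <= m)%N.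
  by rewrite -[LHS]divn_gt0 ?expn_gt0 ?b0// digitS divn_gt0// expn_gt0 b0.
split=> [H|[Hm ad] [|i]].
- split=> [i|]; first by have := H i.+1; rewrite leS digitS.
  have := H 0%N; rewrite expn0 divn1 modnMDl modn_small//; apply.
  by rewrite addn_gt0 muln_gt0 m0 b0.
- by rewrite expn0 divn1 modnMDl modn_small.
- by rewrite leS digitS; exact: Hm.
Qed.

Section kempner_mean.
Variables (R : realType) (b d : nat).
Hypotheses (d_gt0 : (0 < d)%N) (lt_db : (d < b)%N).

Let b_gt0 : 0 < b%:R :> R.
Proof. by rewrite ltr0n (leq_trans _ lt_db). Qed.

Let b_gt1 : (1 < b)%N. Proof. exact: leq_trans lt_db. Qed.

(** The sum W_l(x) of 1/(m+x) over the digit-free integers m with l + 1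
    digits, that is, in [b^l, b^(l+1)). *)
Definition level (l : nat) (x : R) : R :=
  \sum_(b ^ l <= m < b ^ l.+1 | `[< digit_free b d m >]) (m%:R + x)^-1.

(** Writing an integer with l + 2 digits as m b + a, where a is its last
    digit, turns 1/(m b + a + x) into t * 1/(m + (a+x)/b). *)
Lemma levelS l x : level l.+1 x = digit_avg b d (level l) x.
Proof.
rewrite /level big_mkcond/= expnSr [(b ^ l.+2)%N]expnSr sum_nat_digit; last first.
  by rewrite leq_exp2l.
rewrite /digit_avg [in RHS]exchange_big/= mulr_sumr.
rewrite [RHS]big_mkcond/= -expnSr big_nat [RHS]big_nat.
apply: eq_bigr => m /andP[blm mbl].
have m_gt0 : (0 < m)%N by rewrite (leq_trans _ blm)// expn_gt0 (ltnW b_gt1).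
have dfE a : (a < b)%N ->
    `[< digit_free b d (m * b + a) >] = `[< digit_free b d m >] && (a != d).
  move=> ab; apply/asboolP/andP => [/digit_free_rcons[]//Hm /eqP ad|[/asboolP Hm /eqP ad]].
    by split=> //; exact/asboolP.
  exact/digit_free_rcons.
under eq_bigr do rewrite dfE//.
case: asboolP => _ /=; last by rewrite big1.
rewrite mulr_sumr -big_mkcond/=; apply: eq_bigr => a _.
rewrite -invfM; congr (_^-1).
by rewrite mulrDr mulrCA mulfV ?gt_eqF// natrD natrM mulr1 mulrC addrA.
Qed.

Lemma level0E x :
  level 0 x = \sum_(1 <= n < b | n != d) (n%:R + x)^-1.
Proof.
rewrite /level expn0 expn1 big_nat_cond [RHS]big_nat_cond.
apply: eq_bigl => n; rewrite andbC [RHS]andbC; case nb: (1 <= n < b)%N; rewrite ?andbF ?andbT//.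
by apply/asboolP/idP => [/(digit_free_lt d nb)/eqP|/eqP/(digit_free_lt d nb)].
Qed.

Lemma bounded01_level0 : bounded01 (level 0).
Proof.
exists (\sum_(1 <= n < b | n != d) 1) => x /andP[x0 x1]; rewrite level0E.
rewrite (le_trans (ler_norm_sum _ _ _))// big_nat_cond [leRHS]big_nat_cond.
apply: ler_sum => n /andP[/andP[n1 _] _].
have nx : 1 <= n%:R + x.
  by rewrite -[leLHS]addr0 lerD// ler1n.
have nx0 : 0 < n%:R + x by rewrite (lt_le_trans _ nx)// ltr01.
by rewrite gtr0_norm ?invr_gt0// invf_le1.
Qed.

Lemma kempner_mean : kempner R b d = b%:R * mean b d (level 0).
Proof.
have cvgL := cvg_digit_avg_series lt_db bounded01_level0.
rewrite /mean mulrA mulfV ?gt_eqF// mul1r.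
set S := series _ in cvgL *.
pose P m := (0 < m)%N && `[< digit_free b d m >].
rewrite /kempner.
have -> : [set m : nat | (0 < m)%N /\ digit_free b d m] = [set m | P m].
  apply/seteqP; split => m; rewrite /P/=; first by move=> [-> /asboolP].
  by move=> /andP[-> /asboolP].
have term_ge0 m : P m -> (0 <= ((m%:R^-1 : R)%:E))%E by rewrite lee_fin.
rewrite -nneseries_esum//.
have cvgK : cvgn (fun n => \sum_(0 <= m < n | P m) ((m%:R^-1 : R)%:E))%E.
  by apply: is_cvg_nneseries => m _; exact: term_ge0.
have expb_cvg : (fun l => (b ^ l)%N) @ \oo --> \oo.
  move=> A [N _ HN]; exists N => // l /= Nl; apply: HN => /=.
  by rewrite (leq_trans Nl)// ltnW// ltn_expl.
have partial l : (\sum_(0 <= m < b ^ l | P m) ((m%:R^-1 : R)%:E))%E = (S l)%:E.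
  rewrite sumEFin; congr EFin; elim: l => [|l IH].
    by rewrite expn0 big_mkcond big_nat1 /P/= /S /series/= big_geq.
  rewrite (@big_cat_nat _ _ _ (b ^ l)) ?leq_exp2l//= IH /S /series/= big_nat_recr//=.
  congr (_ + _); rewrite (_ : iter l _ _ = level l); last first.
    by elim: l {IH} => // l IH; apply/funext => x; rewrite iterS IH levelS.
  rewrite /level big_nat_cond [RHS]big_nat_cond; apply: eq_big => [m|m _]; last by rewrite addr0.
  rewrite /P; case: (leqP (b ^ l) m) => //= blm.
  by rewrite (leq_trans _ blm)// expn_gt0 (ltnW b_gt1).
have := cvg_comp _ _ expb_cvg cvgK.
rewrite (_ : _ \o _ = EFin \o S); last by apply/funext => l /=; rewrite partial.
by move=> /cvg_lim; rewrite EFin_lim// => <-.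
Qed.

End kempner_mean.

(** * Zeta values and a digamma function *)

Section real_lemmas.
Variable R : realType.
Implicit Types (x z : R) (f g : R ^nat).

Lemma cvg_sum_ord k (F : nat -> R ^nat) (l : nat -> R) :
  (forall j, (j < k)%N -> F j n @[n --> \oo] --> l j) ->
  \sum_(j < k) F j n @[n --> \oo] --> \sum_(j < k) l j.
Proof.
elim: k => [|k IH] Fl.
  rewrite big_ord0 (_ : (fun _ => _) = cst 0); first exact: cvg_cst.
  by apply/funext => n; rewrite big_ord0.
rewrite big_ord_recr/= (_ : (fun _ => _) =
  (fun n => \sum_(j < k) F j n + F k n)); last first.
  by apply/funext => n; rewrite big_ord_recr.
by apply: cvgD; [apply: IH => j jk; apply: Fl; exact: ltnW|exact: Fl].
Qed.

Lemma norm_series_le f g : (forall n, `|f n| <= g n) -> cvgn (series g) ->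
  cvgn (series f) /\ `|limn (series f)| <= limn (series g).
Proof.
move=> fg cg.
have cnf : cvgn [normed series f].
  apply: series_le_cvg cg => // n; last exact: le_trans (fg n).
  exact: normr_ge0.
split; first exact: normed_cvg.
by apply: le_trans (lim_series_norm cnf) _; apply: lim_series_le.
Qed.

Lemma geometric_remainder z J : 1 + z != 0 ->
  (1 + z)^-1 = \sum_(j < J) (- z) ^+ j + (- z) ^+ J / (1 + z).
Proof.
move=> z1; have h : 1 - - z != 0 by rewrite opprK.
apply: (mulIf h); rewrite mulrDl opprK mulfVK// mulVf//.
have := subrXX 1 (- z) J; rewrite expr1n opprK => e.
suff -> : (\sum_(j < J) (- z) ^+ j) * (1 + z) = 1 - (- z) ^+ J by rewrite subrK.
by rewrite mulrC e; congr (_ * _); apply: eq_bigr => i _; rewrite expr1n mul1r.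
Qed.

Lemma invD_taylor (N : R) x J : 1 <= N -> 0 <= x ->
  `|N^-1 - (N + x)^-1 - \sum_(j < J) (-1) ^+ j * N ^- j.+2 * x ^+ j.+1|
    <= x ^+ J.+1 * N ^- 2.
Proof.
move=> N1 x0; have N0 : 0 < N by rewrite (lt_le_trans _ N1)// ltr01.
have Nx0 : 0 < N + x by rewrite ltr_wpDr.
have z1 : 0 < 1 + x / N by rewrite ltr_wpDr// divr_ge0// ltW.
have -> : (N + x)^-1 = N^-1 * (1 + x / N)^-1.
  by rewrite -invfM mulrDr mulr1 mulrCA mulfV ?mulr1// gt_eqF.
rewrite (geometric_remainder J.+1) ?gt_eqF// big_ord_recl/= expr0.
have -> : \sum_(j < J) (-1) ^+ j * N ^- j.+2 * x ^+ j.+1 =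
    - (N^-1 * \sum_(i < J) (- (x / N)) ^+ bump 0 i).
  rewrite mulr_sumr -sumrN; apply: eq_bigr => j _.
  rewrite /bump/= add1n [in RHS]exprNn expr_div_n [(-1) ^+ j.+1]exprS [N ^+ j.+2]exprS.
  by rewrite invfM; ring.
set S := \sum_(i < J) _.
have -> : N^-1 - N^-1 * (1 + S + (- (x / N)) ^+ J.+1 / (1 + x / N)) -
    - (N^-1 * S) = - (N^-1 * (- (x / N)) ^+ J.+1 / (1 + x / N)) by ring.
rewrite normrN !normrM normrX normrN normrM !normfV.
rewrite (ger0_norm x0) (gtr0_norm N0) (gtr0_norm z1) expr_div_n.
rewrite [leLHS](_ : _ = x ^+ J.+1 * (N^-1 * N^-1 * N ^- J / (1 + x / N))).
  rewrite ler_wpM2l ?exprn_ge0// (_ : N ^- 2 = N^-1 / N); last first.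
    by rewrite expr2 invfM.
  rewrite -(mulrA (N^-1 / N)) ler_piMr ?mulr_ge0 ?invr_ge0 ?(ltW N0)//.
  rewrite mulr_ile1 ?invr_ge0 ?exprn_ge0 ?(ltW N0) ?(ltW z1)//.
    by rewrite invf_le1 ?exprn_gt0// exprn_ege1.
  by rewrite invf_le1// lerDl divr_ge0// ltW.
by rewrite [N ^+ J.+1]exprS invfM; ring.
Qed.

(** The exponent is k + 2, so that the series converges. *)
Lemma cvg_zeta (k : nat) : cvgn (series (fun n => n.+1%:R ^- k.+2 : R)).
Proof.
apply: nondecreasing_is_cvgn.
  apply/nondecreasing_seqP => n; rewrite /series/= big_nat_recr//= lerDl.
  by rewrite invr_ge0 exprn_ge0.
(* The partial sums of length n + 1 are at most 2 - 1/(n+1). *)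
exists 2 => _ [[|n] _ <-]; first by rewrite /series/= big_geq.
apply: (@le_trans _ _ (2 - n.+1%:R^-1)); last by rewrite gerBl invr_ge0.
elim: n => [|n IH].
  by rewrite /series/= big_nat1 expr1n invr1 -[2]/(1 + 1 : R) addrK.
rewrite /series/= big_nat_recr//=.
have pos m : 0 < m.+1%:R :> R by rewrite ltr0n.
apply: (@le_trans _ _ (2 - n.+1%:R^-1 + (n.+1%:R * n.+2%:R)^-1)).
  rewrite lerD// lef_pV2 ?posrE ?exprn_gt0 ?mulr_gt0//.
  apply: (@le_trans _ _ (n.+2%:R ^+ 2)); last by rewrite ler_eXn2l ?ltr1n.
  by rewrite expr2 ler_wpM2r// ler_nat.
rewrite -[n.+2%:R]natr1 le_eqVlt; apply/orP; left; apply/eqP.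
move: (pos n); move: n.+1%:R => m m0.
by field; rewrite !gt_eqF//; lra.
Qed.

Lemma zetaE (k : nat) : zeta k%:R = limn (series (fun n => n.+1%:R ^- k : R)).
Proof.
rewrite /zeta; congr (limn (series _)); apply/funext => n.
by rewrite /riemannR powR_mulrn.
Qed.

(** The digamma function at 1 + x plus the Euler constant, normalised so as to
    vanish at 0. *)
Definition digam x : R := limn (series (fun n => n.+1%:R^-1 - (n.+1%:R + x)^-1)).

Lemma cvg_digam x : 0 <= x ->
  cvgn (series (fun n => n.+1%:R^-1 - (n.+1%:R + x)^-1)).
Proof.
move=> x0.
have := @norm_series_le (fun n => n.+1%:R^-1 - (n.+1%:R + x)^-1)
  (fun n => x * n.+1%:R ^- 2).
case=> // [n|].
  have := @invD_taylor n.+1%:R x 0; rewrite big_ord0 subr0 expr1; apply => //.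
  by rewrite ler1n.
rewrite (_ : series _ = (fun n => x * series (fun n => n.+1%:R ^- 2 : R) n)).
  by apply: is_cvgM; [exact: is_cvg_cst|exact: cvg_zeta].
by apply/funext => n; rewrite /series/= mulr_sumr.
Qed.

Lemma digam_taylor x J : 0 <= x ->
  `|digam x - \sum_(j < J) (-1) ^+ j * zeta (j.+2)%:R * x ^+ j.+1|
    <= zeta 2 * x ^+ J.+1.
Proof.
move=> x0.
set f := fun n : nat => n.+1%:R^-1 - (n.+1%:R + x)^-1.
set g := fun j : nat => (fun n : nat => (-1) ^+ j * n.+1%:R ^- j.+2 * x ^+ j.+1).
pose h n := f n - \sum_(j < J) g j n.
have lim_g j : series (g j) n @[n --> \oo] -->
    ((-1) ^+ j * zeta (j.+2)%:R * x ^+ j.+1 : R).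
  rewrite (_ : series _ = (fun n => (-1) ^+ j *
    series (fun n => n.+1%:R ^- j.+2 : R) n * x ^+ j.+1)).
    apply: cvgM; last exact: cvg_cst.
    by apply: cvgM; [exact: cvg_cst|rewrite zetaE; exact: cvg_zeta].
  by apply/funext => n; rewrite /series/= mulr_sumr mulr_suml.
have lim_h : series h n @[n --> \oo] -->
    (digam x - \sum_(j < J) (-1) ^+ j * zeta (j.+2)%:R * x ^+ j.+1 : R).
  rewrite (_ : series h =
      (fun n => series f n - \sum_(j < J) series (g j) n)); last first.
    apply/funext => n; rewrite /series/= sumrB; congr (_ - _).
    by rewrite exchange_big.
  by apply: cvgB; [exact: cvg_digam|apply: (@cvg_sum_ord J
    (fun j => series (g j)) (fun j => (-1) ^+ j * zeta (j.+2)%:R * x ^+ j.+1))].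
have lim_k : series (fun n => x ^+ J.+1 * n.+1%:R ^- 2 : R) n @[n --> \oo] -->
    (zeta 2 * x ^+ J.+1 : R).
  rewrite (_ : series _ = (fun n => series (fun n => n.+1%:R ^- 2 : R) n * x ^+ J.+1)).
    by apply: cvgM; [rewrite zetaE; exact: cvg_zeta|exact: cvg_cst].
  by apply/funext => n; rewrite /series/= mulr_suml; apply: eq_bigr => i _; rewrite mulrC.
have [|_] := @norm_series_le h (fun n => x ^+ J.+1 * n.+1%:R ^- 2) _ (cvgP _ lim_k).
  by move=> n; apply: invD_taylor => //; rewrite ler1n.
by rewrite (cvg_lim _ lim_h)// (cvg_lim _ lim_k).
Qed.

Lemma digam0 : digam 0 = 0.
Proof.
have := digam_taylor 0 (lexx 0).
by rewrite big_ord0 subr0 expr1 mulr0 normr_le0 => /eqP.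
Qed.

End real_lemmas.

(** * An exact formula for the Kempner sum *)

Section digamma_formula.
Variables (R : realType) (b d : nat).
Hypotheses (d_gt0 : (0 < d)%N) (lt_db : (d < b)%N).
Implicit Types (x : R).

Let b_gt0 : 0 < b%:R :> R.
Proof. by rewrite ltr0n (leq_trans _ lt_db). Qed.

Let b_gt1 : (1 < b)%N. Proof. exact: leq_trans lt_db. Qed.

Lemma ln_succ_bounds (m : nat) : (0 < m)%N ->
  m.+1%:R^-1 <= ln (m.+1%:R : R) - ln m%:R <= m%:R^-1.
Proof.
move=> m0; have mp : 0 < m%:R :> R by rewrite ltr0n.
have mp1 : 0 < m.+1%:R :> R by rewrite ltr0n.
have im : 0 < m%:R^-1 :> R by rewrite invr_gt0.
have im1 : 0 < m.+1%:R^-1 :> R by rewrite invr_gt0.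
have im2 : m.+1%:R^-1 < 1 :> R by rewrite invf_lt1// ltr1n.
rewrite -ln_div ?posrE//; apply/andP; split.
  rewrite -[leRHS]opprK lerNr -lnV ?posrE ?divr_gt0// invf_div.
  rewrite (_ : _ / _ = 1 + - m.+1%:R^-1); first by apply: le_ln1Dx; rewrite ltrN2.
  by rewrite -{1}[m%:R](addrK 1) natr1 mulrBl mulfV ?gt_eqF// mul1r.
rewrite (_ : _ / _ = 1 + m%:R^-1); first by apply: le_ln1Dx; rewrite (lt_trans _ im)// ltrN10.
by rewrite -natr1 mulrDl mulfV ?gt_eqF// mul1r.
Qed.

(** By comparison with the logarithm, the block differs from log b by at most
    1/(n+1). *)
Lemma cvg_harmonic_block :
  \sum_(n.+1 <= m < n.+1 * b) (m%:R^-1 : R) @[n --> \oo] --> ln b%:R.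
Proof.
have nb n : (n.+1 <= n.+1 * b)%N by rewrite leq_pmulr// ltnW.
have bounds n : ln b%:R <= \sum_(n.+1 <= m < n.+1 * b) (m%:R^-1 : R)
    <= ln b%:R + n.+1%:R^-1.
  have lnE : ln b%:R = \sum_(n.+1 <= m < n.+1 * b) (ln m.+1%:R - ln m%:R) :> R.
    rewrite (telescope_sumr (fun m => ln (m%:R : R)))//.
    by rewrite natrM lnM ?posrE ?ltr0n// ?(ltnW b_gt1)// [X in _ = X - _]addrC addrK.
  rewrite lnE; apply/andP; split.
    rewrite !big_nat; apply: ler_sum => m /andP[nm _].
    by have /andP[] := ln_succ_bounds (leq_ltn_trans (leq0n n) nm).
  rewrite addrC -lerBlDr -sumrB.
  apply: (@le_trans _ _ (\sum_(n.+1 <= m < n.+1 * b) (m%:R^-1 - m.+1%:R^-1))).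
    rewrite !big_nat; apply: ler_sum => m /andP[nm _].
    have /andP[h1 h2] := ln_succ_bounds (leq_ltn_trans (leq0n n) nm).
    by rewrite lerD2l lerN2.
  rewrite (eq_bigr (fun m => - (m.+1%:R^-1 - m%:R^-1))); last first.
    by move=> m _; rewrite opprB.
  rewrite sumrN (telescope_sumr (fun m => (m%:R : R)^-1))// opprB.
  by rewrite gerBl invr_ge0.
apply: (squeeze_cvgr _ (cvg_cst (ln b%:R))).
  by near=> n; exact: bounds.
rewrite -[X in _ --> X]addr0; apply: cvgD; first exact: cvg_cst.
exact: cvg_harmonic.
Unshelve. all: by end_near. Qed.

(** The multiplication formula of the digamma function: on partial sums,
    averaging over the digits regroups the integers of [b, (N+1)b) by their
    quotient by b. *)
Lemma avg_digam x : 0 <= x <= 1 ->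
  avg b (@digam R) x - digam x = \sum_(1 <= n < b) (n%:R + x)^-1 - ln b%:R.
Proof.
move=> x01; have /andP[x0 x1] := x01.
pose p N y : R := \sum_(0 <= n < N) (n.+1%:R^-1 - (n.+1%:R + y)^-1).
have cvg_p y : 0 <= y -> p N y @[N --> \oo] --> digam y by exact: cvg_digam.
have cvg_avg : avg b (p N) x @[N --> \oo] --> avg b (@digam R) x.
  apply: cvgM; first exact: cvg_cst.
  apply: (@cvg_sum_ord R b (fun a N => p N ((a%:R + x) / b%:R))
    (fun a => digam ((a%:R + x) / b%:R))) => a ab.
  by apply: cvg_p; have /andP[] := digit01 lt_db ab x01.
have sub_cvg : (fun N => (N.+1 * b).-1)%N @ \oo --> \oo.
  move=> A [N _ HN]; exists N => // n /= Nn; apply: HN => /=.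
  rewrite (leq_trans Nn)// -ltnS prednK ?muln_gt0 ?(ltnW b_gt1)//.
  by rewrite leq_pmulr// ltnW.
have cvg_sub : p (N.+1 * b).-1 x @[N --> \oo] --> digam x.
  exact: (cvg_comp _ (p ^~ x) sub_cvg (cvg_p _ x0)).
(* Both partial sums involve the same terms 1/(m+x) with b <= m < (N+1)b. *)
have key N : avg b (p N) x - p (N.+1 * b).-1 x
    = \sum_(1 <= n < b) (n%:R + x)^-1 - \sum_(N.+1 <= m < N.+1 * b) m%:R^-1.
  have Nb1 : (N < (N.+1 * b).-1.+1)%N.
    by rewrite prednK ?muln_gt0 ?(ltnW b_gt1)// leq_pmulr// ltnW.
  have Nb : (N.+1 * b).-1.+1 = (N.+1 * b)%N.
    by rewrite prednK ?muln_gt0 ?(ltnW b_gt1).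
  have -> : p (N.+1 * b).-1 x = \sum_(1 <= m < N.+1 * b) m%:R^-1
      - \sum_(1 <= m < N.+1 * b) (m%:R + x)^-1.
    by rewrite /p sumrB -Nb !big_add1.
  have -> : avg b (p N) x = \sum_(1 <= m < N.+1) m%:R^-1
      - \sum_(b <= m < N.+1 * b) (m%:R + x)^-1.
    rewrite /avg /p.
    under eq_bigr do rewrite sumrB.
    rewrite sumrB sumr_const card_ord mulrBr -[X in _ * X - _]mulr_natl mulKf ?gt_eqF//.
    rewrite big_add1/=; congr (_ - _).
    rewrite [RHS](_ : _ = \sum_(1 * b <= m < N.+1 * b) (m%:R + x)^-1); last first.
      by rewrite mul1n.
    rewrite sum_nat_digit// big_add1/= exchange_big/= mulr_sumr.
    apply: eq_bigr => n _; rewrite mulr_sumr; apply: eq_bigr => a _.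
    rewrite -invfM; congr (_^-1).
    by rewrite mulrDr [b%:R * (_ / _)]mulrCA mulfV ?gt_eqF// natrD natrM mulr1 mulrC addrA.
  rewrite (@big_cat_nat _ _ _ N.+1 1 (N.+1 * b))//=; last by rewrite leq_pmulr// ltnW.
  rewrite (@big_cat_nat _ _ _ b 1 (N.+1 * b))//= ?leq_pmull ?(ltnW b_gt1)//.
  by ring.
have lim1 : (fun N => \sum_(1 <= n < b) (n%:R + x)^-1
    - \sum_(N.+1 <= m < N.+1 * b) m%:R^-1) @ \oo
    --> avg b (@digam R) x - digam x.
  by rewrite -(funext key); exact: cvgB.
have lim2 : (fun N => \sum_(1 <= n < b) (n%:R + x)^-1
    - \sum_(N.+1 <= m < N.+1 * b) m%:R^-1) @ \oo
    --> \sum_(1 <= n < b) (n%:R + x)^-1 - ln b%:R.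
  by apply: cvgB; [exact: cvg_cst|exact: cvg_harmonic_block].
by rewrite -(cvg_lim _ lim1)// (cvg_lim _ lim2).
Qed.

Lemma bounded01_digam : bounded01 (@digam R).
Proof.
exists (zeta 2) => x /andP[x0 x1].
have := digam_taylor 0 x0; rewrite big_ord0 subr0 expr1.
move=> /le_trans; apply; rewrite ler_piMr//.
have := digam_taylor 0 (@ler01 R); rewrite expr1 mulr1; exact: le_trans.
Qed.

Lemma d_gt0R : 0 < d%:R :> R. Proof. by rewrite ltr0n. Qed.

Lemma bounded01_inv : bounded01 (fun x => (d%:R + x)^-1).
Proof.
exists (d%:R^-1) => x /andP[x0 x1]; have dR := d_gt0R.
have dx : 0 < d%:R + x by rewrite ltr_wpDr.
by rewrite gtr0_norm ?invr_gt0// lef_pV2 ?posrE// lerDl.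
Qed.

(** The contributions of digam to the fixed-point equation cancel, except for
    that of the digit d. *)
Lemma kempner_digam :
  kempner R b d = b%:R * ln b%:R - b%:R * mean b d (fun x => (d%:R + x)^-1)
    + mean b d (fun x => digam ((d%:R + x) / b%:R)).
Proof.
have bi := bounded01_inv; have bg := bounded01_digam.
have bag := bounded01_avg lt_db bg.
have bl : bounded01 (fun=> ln b%:R : R) := bounded01_cst _.
rewrite kempner_mean//.
have -> : mean b d (level b d 0) = mean b d (fun x =>
    ((avg b (@digam R) x - digam x) + ln b%:R) - (d%:R + x)^-1).
  apply: eq_mean => //; first exact: bounded01_level0.
  move=> x x01; rewrite level0E// avg_digam// subrK.
  rewrite (bigD1_seq d)/= ?iota_uniq ?mem_index_iota ?d_gt0//.
  by rewrite [RHS]addrC addKr.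
have b1 : bounded01 (fun x : R => avg b (@digam R) x - digam x).
  exact: bounded01B.
have b2 : bounded01 (fun x : R => avg b (@digam R) x - digam x + ln b%:R).
  exact: bounded01D.
rewrite meanB// meanD// meanB// mean_cst// [mean b d (@digam R)]mean_eq//.
by rewrite digam0 mulr0 add0r; field; rewrite gt_eqF.
Qed.

End digamma_formula.

(** * Taylor estimates for negative powers and the logarithm *)

Section taylor.
Variable R : realType.
Implicit Types (z u c : R).

(** The coefficient of z^j in (1+z)^(-(r+1)); the exponent is shifted by one
    so that the binomial coefficient has no truncated subtraction. *)
Definition negbin (r j : nat) : R := (-1) ^+ j * 'C(r + j, j)%:R.

Lemma negbin_r0 r : negbin r 0 = 1.
Proof. by rewrite /negbin expr0 bin0 mul1r. Qed.

Lemma negbin0 j : negbin 0 j = (-1) ^+ j.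
Proof. by rewrite /negbin add0n binn mulr1. Qed.

Lemma negbinS r j : negbin r.+1 j.+1 = negbin r j.+1 - negbin r.+1 j.
Proof.
by rewrite /negbin !addSn !addnS binS natrD exprS; ring.
Qed.

Lemma negbin1 r : negbin r 1 = - r.+1%:R.
Proof. by rewrite /negbin expr1 addn1 bin1 mulN1r. Qed.

Lemma mul1D_negbin r J z :
  (1 + z) * \sum_(j < J.+1) negbin r.+1 j * z ^+ j =
  \sum_(j < J.+1) negbin r j * z ^+ j + negbin r.+1 J * z ^+ J.+1.
Proof.
elim: J => [|J IH].
  by rewrite !big_ord1 !negbin_r0 !expr1 expr0; ring.
rewrite big_ord_recr/= mulrDr IH [in RHS]big_ord_recr/= negbinS.
by rewrite [z ^+ J.+2]exprS; ring.
Qed.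

Lemma inv_pow_taylor r J : exists2 C : R, 0 <= C & forall z, 0 <= z ->
  `|(1 + z) ^- r.+1 - \sum_(j < J) negbin r j * z ^+ j| <= C * z ^+ J.
Proof.
have inv1D z : 0 <= z -> 0 < 1 + z /\ (1 + z)^-1 <= 1.
  move=> z0; have z1 : 0 < 1 + z by rewrite ltr_wpDr.
  by rewrite invf_le1// lerDl.
elim: r => [|r [C C0 HC]].
  exists 1 => // z z0; have [z1 iz] := inv1D _ z0.
  rewrite expr1 (geometric_remainder J) ?gt_eqF//.
  under eq_bigr do rewrite exprNn.
  under [X in _ - X]eq_bigr do rewrite negbin0.
  rewrite addrC addKr normrM normrX normrN (ger0_norm z0) mul1r.
  by rewrite gtr0_norm ?invr_gt0// ler_piMr// exprn_ge0.
case: J HC => [|J] HC.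
  exists 1 => // z z0; have [z1 iz] := inv1D _ z0.
  rewrite big_ord0 subr0 expr0 mulr1 gtr0_norm ?invr_gt0 ?exprn_gt0//.
  by rewrite -exprVn exprn_ile1// invr_ge0 ltW.
exists (C + `|negbin r.+1 J|); first by rewrite addr_ge0.
move=> z z0; have [z1 iz] := inv1D _ z0.
have -> : (1 + z) ^- r.+2 - \sum_(j < J.+1) negbin r.+1 j * z ^+ j =
    (1 + z)^-1 * ((1 + z) ^- r.+1 - \sum_(j < J.+1) negbin r j * z ^+ j
      - negbin r.+1 J * z ^+ J.+1).
  rewrite -addrA -opprD -mul1D_negbin mulrBr mulrA mulVf ?gt_eqF// mul1r.
  by rewrite -invfM -exprS.
rewrite normrM gtr0_norm ?invr_gt0// mulrDl.
rewrite -[leRHS]mul1r ler_pM ?invr_ge0 ?(ltW z1)//.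
rewrite (le_trans (ler_normB _ _))// lerD ?HC//.
by rewrite normrM normrX (ger0_norm z0).
Qed.

(** The constant C is uniform in c >= 1. *)
Lemma inv_pow_taylor_scaled r J : exists2 C : R, 0 <= C & forall c u,
  1 <= c -> 0 <= u ->
  `|(c + u) ^- r.+1 - \sum_(j < J) negbin r j * c ^- (r.+1 + j) * u ^+ j|
    <= C * u ^+ J.
Proof.
have [C C0 HC] := inv_pow_taylor r J.
exists C => // c u c1 u0; have c0 : 0 < c by rewrite (lt_le_trans _ c1)// ltr01.
have uc0 : 0 <= u / c by rewrite divr_ge0// ltW.
have -> : (c + u) ^- r.+1 - \sum_(j < J) negbin r j * c ^- (r.+1 + j) * u ^+ j
  = c ^- r.+1 * ((1 + u / c) ^- r.+1 - \sum_(j < J) negbin r j * (u / c) ^+ j).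
  rewrite mulrBr -invfM -exprMn mulrDr mulr1 mulrCA mulfV ?gt_eqF// mulr1.
  congr (_ - _); rewrite mulr_sumr; apply: eq_bigr => j _.
  by rewrite exprD invfM expr_div_n; ring.
have ic : `|c ^- r.+1| <= 1.
  rewrite gtr0_norm ?invr_gt0 ?exprn_gt0// invf_le1 ?exprn_gt0//.
  by rewrite exprn_ege1.
rewrite normrM -[leRHS]mul1r ler_pM// (le_trans (HC _ uc0))//.
rewrite ler_wpM2l// lerXn2r ?nnegrE// ler_pdivrMr// ler_peMr//.
Qed.

Let lnpoly J : {poly R} := \sum_(j < J) ((-1) ^+ j / j.+1%:R) *: 'X^(j.+1).

Let lnpolyE J z :
  (lnpoly J).[z] = \sum_(j < J) (-1) ^+ j / j.+1%:R * z ^+ j.+1.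
Proof. by rewrite horner_sum; apply: eq_bigr => j _; rewrite hornerZ hornerXn. Qed.

Let deriv_lnpoly J z : (lnpoly J)^`().[z] = \sum_(j < J) (- z) ^+ j.
Proof.
rewrite raddf_sum horner_sum; apply: eq_bigr => j _ /=.
rewrite derivZ derivXn hornerZ hornerMn hornerXn [in RHS]exprNn /= -[z ^+ j *+ _]mulr_natr.
have : j.+1%:R != 0 :> R by rewrite pnatr_eq0.
by move: (j.+1%:R : R) => n n0; field.
Qed.

Let is_derive_ln_lnpoly J z : 0 <= z ->
  is_derive z 1 (fun z => ln (1 + z) - (lnpoly J).[z])
   ((1 + z)^-1 - \sum_(j < J) (- z) ^+ j).
Proof.
move=> z0; have z1 : 0 < 1 + z by rewrite ltr_wpDr.
apply: is_deriveB; last by rewrite -deriv_lnpoly; exact: is_derive_poly.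
have := @is_derive1_comp R (@ln R) (fun z => 1 + z) z.
move=> /(_ (1 + z)^-1 1); rewrite mulr1; apply.
  exact: is_derive1_ln.
by rewrite -[X in is_derive _ _ _ X]add0r; apply: is_deriveD.
Qed.

(** The derivative of the difference is (-z)^J / (1+z), by the geometric sum;
    the mean value theorem concludes. *)
Lemma ln_taylor J z : 0 <= z ->
  `|ln (1 + z) - \sum_(j < J) (-1) ^+ j / j.+1%:R * z ^+ j.+1| <= z ^+ J.+1.
Proof.
rewrite le_eqVlt => /predU1P[<-|z0].
  rewrite addr0 ln1 big1 ?subr0 ?normr0 ?exprn_ge0// => i _.
  by rewrite expr0n/= mulr0.
rewrite -lnpolyE.
have dh x : x \in `]0, z[ -> is_derive x 1
    (fun z => ln (1 + z) - (lnpoly J).[z]) ((1 + x)^-1 - \sum_(j < J) (- x) ^+ j).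
  by rewrite in_itv/= => /andP[/ltW x0 _]; exact: is_derive_ln_lnpoly.
have [|c] := MVT z0 dh.
  apply: derivable_within_continuous => x; rewrite in_itv/= => /andP[x0 _].
  by have [] := is_derive_ln_lnpoly J x0.
rewrite in_itv/= => /andP[c0 cz].
rewrite addr0 ln1 (lnpolyE J 0) [X in _ - (0 - X)]big1 ?subr0; last first.
  by move=> i _; rewrite expr0n/= mulr0.
move=> ->; have c1 : 0 < 1 + c by rewrite ltr_wpDr// ltW.
rewrite (geometric_remainder J) ?gt_eqF// addrC addKr.
rewrite !normrM normrX normrN (gtr0_norm c0) (gtr0_norm z0) exprSr.
rewrite ler_wpM2r ?(ltW z0)// gtr0_norm ?invr_gt0//.
apply: (@le_trans _ _ (c ^+ J)); last by rewrite lerXn2r ?nnegrE ?ltW.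
by rewrite ler_piMr ?exprn_ge0 ?ltW// invf_lt1// ltrDl.
Qed.

Lemma ln_taylor_scaled J c u : 1 <= c -> 0 <= u ->
  `|ln (c + u) - ln c
    - \sum_(j < J) (-1) ^+ j / j.+1%:R * c ^- j.+1 * u ^+ j.+1| <= u ^+ J.+1.
Proof.
move=> c1 u0; have c0 : 0 < c by rewrite (lt_le_trans _ c1)// ltr01.
have uc0 : 0 <= u / c by rewrite divr_ge0// ltW.
have -> : ln (c + u) - ln c = ln (1 + u / c).
  rewrite -ln_div ?posrE// ?ltr_wpDr//; congr ln.
  by rewrite mulrDl mulfV// gt_eqF.
rewrite (eq_bigr (fun j : 'I_J => (-1) ^+ j / j.+1%:R * (u / c) ^+ j.+1)); last first.
  by move=> j _; rewrite expr_div_n -mulrA [c ^- _ * _]mulrC.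
rewrite (le_trans (ln_taylor J uc0))//.
by rewrite lerXn2r ?nnegrE// ler_pdivrMr// ler_peMr.
Qed.

End taylor.

(** * Moments and telescoping sums *)

Section moments.
Variables (R : realType) (d : nat).
Hypothesis d_gt0 : (0 < d)%N.
Implicit Types (b : nat) (x : R).

(** The moments U_j, V_j, E_j and G_s, as functions of the base b. *)
Definition momU (j b : nat) : R := mean b d (fun x => x ^+ j).
Definition momV (j b : nat) : R := mean b d (fun x => (d%:R + x) ^+ j).
Definition momE (j b : nat) : R := mean b d (avg b (fun x => x ^+ j)).
Definition momG (s b : nat) : R := mean b d (avg b (fun x => (d%:R + x) ^- s)).

(** The difference of w^(-s) between w = d + 1 and w = d, which arises as the
    boundary term of a telescoping sum. *)
Definition gap (s : nat) : R := (d%:R + 1) ^- s - d%:R ^- s.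

Let d1 : 1 <= d%:R :> R. Proof. by rewrite ler1n. Qed.

Lemma bounded01_X j : bounded01 (fun x : R => x ^+ j).
Proof.
exists 1 => x /andP[x0 x1].
by rewrite ger0_norm ?exprn_ge0// exprn_ile1.
Qed.

Lemma bounded01_dX j : bounded01 (fun x : R => (d%:R + x) ^+ j).
Proof.
exists ((d%:R + 1) ^+ j) => x /andP[x0 x1].
by rewrite ger0_norm ?exprn_ge0 ?addr_ge0// lerXn2r ?nnegrE ?addr_ge0// lerD2l.
Qed.

Lemma bounded01_dV s : bounded01 (fun x : R => (d%:R + x) ^- s).
Proof.
exists 1 => x /andP[x0 x1].
have dx : 1 <= d%:R + x by rewrite (le_trans d1)// lerDl.
have dx0 : 0 < d%:R + x by rewrite (lt_le_trans _ dx)// ltr01.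
by rewrite gtr0_norm ?invr_gt0 ?exprn_gt0// invf_le1 ?exprn_gt0// exprn_ege1.
Qed.

Section fixed_base.
Variable b : nat.
Hypothesis lt_db : (d < b)%N.
Local Notation t := (b%:R^-1 : R).

Let b_gt0 : 0 < b%:R :> R.
Proof. by rewrite ltr0n (leq_trans _ lt_db). Qed.

Let t_gt0 : 0 < t. Proof. by rewrite invr_gt0. Qed.

Let t_le1 : t <= 1.
Proof. by rewrite invf_le1// ler1n (leq_trans _ lt_db). Qed.

Lemma mean_lin_comb J (c : nat -> R) (F : nat -> R -> R) :
  (forall j, bounded01 (F j)) ->
  mean b d (fun x => \sum_(j < J) c j * F j x) = \sum_(j < J) c j * mean b d (F j).
Proof.
move=> bF; rewrite (@mean_sum _ _ _ lt_db J (fun j x => c j * F j x)).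
  by apply: eq_bigr => j _; rewrite meanZ.
by move=> j _; exact: bounded01Z.
Qed.

Lemma mean_approx J (c : nat -> R) (F : nat -> R -> R) (f : R -> R) (C : R) :
  bounded01 f -> (forall j, bounded01 (F j)) ->
  (forall x, 0 <= x <= 1 -> `|f x - \sum_(j < J) c j * F j x| <= C) ->
  `|mean b d f - \sum_(j < J) c j * mean b d (F j)| <= C.
Proof.
move=> bf bF HC; rewrite -mean_lin_comb// -meanB//; last first.
  by apply: (@bounded01_sum _ J (fun j x => c j * F j x)) => j _; exact: bounded01Z.
exact: norm_mean_le.
Qed.

Lemma momV_sum j : momV j b = \sum_(i < j.+1) d%:R ^+ (j - i) *+ 'C(j, i) * momU i b.
Proof.
rewrite -(@mean_lin_comb j.+1 (fun i => d%:R ^+ (j - i) *+ 'C(j, i))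
  (fun i x => x ^+ i)); last exact: bounded01_X.
congr mean; apply/funext => x; rewrite exprDn.
by apply: eq_bigr => i _; rewrite mulrnAl.
Qed.

(** The fixed-point equation for x^j. *)
Lemma momU_recE j : momU j b = t * 0 ^+ j + momE j b - t ^+ j.+1 * momV j b.
Proof.
rewrite /momU [LHS]mean_eq//; last exact: bounded01_X.
congr (_ - _); rewrite exprS -mulrA; congr (_ * _).
rewrite -meanZ//; last exact: bounded01_dX.
by congr mean; apply/funext => x; rewrite expr_div_n mulrC exprVn.
Qed.

Lemma node_succ (a : nat) x : (a%:R + x) / b%:R + t = (a.+1%:R + x) / b%:R.
Proof. by rewrite -natr1 [in RHS]addrAC [RHS]mulrDl mul1r. Qed.

Lemma sum_node (F : R -> R) x :
  \sum_(a < b) (F ((a%:R + x) / b%:R + t) - F ((a%:R + x) / b%:R)) =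
  F (1 + t * x) - F (t * x).
Proof.
have := telescope_sumr (fun a => F ((a%:R + x) / b%:R)) (leq0n b).
rewrite big_mkord add0r mulrDl mulfV ?gt_eqF// mulrC => <-.
by apply: eq_bigr => a _; rewrite node_succ.
Qed.

Lemma sum_avg (f : R -> R) x : \sum_(a < b) t * f ((a%:R + x) / b%:R) = avg b f x.
Proof. by rewrite /avg mulr_sumr. Qed.

(** The telescoping sum for w^(j+1). *)
Lemma momE_rec j :
  \sum_(i < j.+1) 'C(j.+1, i)%:R * t ^+ (j - i) * momE i b =
  \sum_(i < j.+1) 'C(j.+1, i)%:R * t ^+ i * momU i b.
Proof.
rewrite -(@mean_lin_comb j.+1 (fun i => 'C(j.+1, i)%:R * t ^+ (j - i))
  (fun i => avg b (fun x => x ^+ i))); last first.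
  by move=> i; apply: (bounded01_avg lt_db); exact: bounded01_X.
rewrite -(@mean_lin_comb j.+1 (fun i => 'C(j.+1, i)%:R * t ^+ i)
  (fun i x => x ^+ i)); last exact: bounded01_X.
congr mean; apply/funext => x.
transitivity ((1 + t * x) ^+ j.+1 - (t * x) ^+ j.+1); last first.
  rewrite exprDn big_ord_recr/= subnn expr0 binn mulr1n mul1r addrK.
  by apply: eq_bigr => i _; rewrite expr1n mul1r exprMn -mulr_natl mulrA.
rewrite -(sum_node (fun y => y ^+ j.+1)).
under eq_bigr do rewrite /avg mulrA mulr_sumr.
rewrite exchange_big/=; apply: eq_bigr => a _.
set w := (a%:R + x) / b%:R; apply: esym.
rewrite [w + t]addrC exprDn big_ord_recr/=.
rewrite subnn expr0 binn mulr1n mul1r addrK; apply: eq_bigr => i _.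
rewrite subSn; last by rewrite -ltnS.
rewrite -[LHS]mulr_natl exprSr.
by rewrite !mulrA.
Qed.

(** If F(w+t) - F(w) has a Taylor expansion in t with coefficients beta_j
    f_j(w), the telescoping sum gives an expansion in terms of the averages of
    the f_j. One power of t is lost, because b terms are added. *)
Lemma telescope_approx J (F : R -> R) (f : nat -> R -> R) (beta : nat -> R) (C : R) :
  (forall w, 0 <= w -> `|F (w + t) - F w
     - \sum_(j < J) beta j * t ^+ j.+1 * f j w| <= C * t ^+ J.+1) ->
  forall x, 0 <= x <= 1 ->
  `|F (1 + t * x) - F (t * x) - \sum_(j < J) beta j * t ^+ j * avg b (f j) x|
    <= C * t ^+ J.
Proof.
move=> HC x x01; rewrite -sum_node.
have -> : \sum_(j < J) beta j * t ^+ j * avg b (f j) x =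
    \sum_(a < b) \sum_(j < J) beta j * t ^+ j.+1 * f j ((a%:R + x) / b%:R).
  rewrite exchange_big/=; apply: eq_bigr => j _.
  rewrite -sum_avg mulr_sumr; apply: eq_bigr => a _.
  by rewrite exprSr; ring.
rewrite -sumrB (le_trans (ler_norm_sum _ _ _))//.
apply: (@le_trans _ _ (\sum_(a < b) C * t ^+ J.+1)).
  apply: ler_sum => a _; apply: HC.
  by have /andP[] := digit01 lt_db (ltn_ord a) x01.
rewrite sumr_const card_ord -[leLHS]mulr_natl exprS mulrCA mulVKf ?gt_eqF//.
Qed.

End fixed_base.

End moments.

(** * Relations between negative and positive moments *)

Section relations.
Variables (R : realType) (d : nat).
Hypothesis d_gt0 : (0 < d)%N.
Implicit Types (b : nat) (x : R).

Let d1 : 1 <= d%:R :> R. Proof. by rewrite ler1n. Qed.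

Let t_gt0 b : (d < b)%N -> 0 < b%:R^-1 :> R.
Proof. by move=> db; rewrite invr_gt0 ltr0n (leq_trans _ db). Qed.

Let t_le1 b : (d < b)%N -> b%:R^-1 <= 1 :> R.
Proof.
by move=> db; rewrite invf_le1 ?ler1n ?ltr0n ?(leq_trans _ db).
Qed.

Let tx_le b x : (d < b)%N -> 0 <= x <= 1 -> 0 <= b%:R^-1 * x <= b%:R^-1.
Proof.
move=> db /andP[x0 x1]; have t0 := t_gt0 db.
by rewrite mulr_ge0 ?(ltW t0)//= ler_piMr// ltW.
Qed.

Lemma norm_sub3 (a1 a2 a3 c1 c2 c3 : R) :
  `|a1| <= c1 -> `|a2| <= c2 -> `|a3| <= c3 -> `|a2 - a1 - a3| <= c1 + c2 + c3.
Proof.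
move=> h1 h2 h3; rewrite (le_trans (ler_normB _ _))// lerD//.
by rewrite (le_trans (ler_normB _ _))// addrC lerD.
Qed.

(** The telescoping sum for (d+w)^(-(r+1)). *)
Lemma momG_rel r J : exists2 C : R, 0 <= C & forall b, (d < b)%N ->
  `|\sum_(j < J) negbin R r j.+1 * b%:R^-1 ^+ j * momG R d (r.+2 + j) b
    - \sum_(j < J) negbin R r j * gap R d (r.+1 + j) * b%:R^-1 ^+ j * momU R d j b|
    <= C * b%:R^-1 ^+ J.
Proof.
have [C C0 HC] := inv_pow_taylor_scaled R r J.+1.
have [D D0 HD] := inv_pow_taylor_scaled R r J.
exists (C + D + D); first by rewrite !addr_ge0.
move=> b db; have t0 := t_gt0 db; set t := b%:R^-1 in t0 *.
pose f (j : nat) (w : R) := (d%:R + w) ^- (r.+2 + j).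
have bf j : bounded01 (avg b (f j)).
  by apply: (bounded01_avg db); exact: bounded01_dV.
rewrite -(@mean_lin_comb _ _ _ db J (fun j => negbin R r j.+1 * t ^+ j)
  (fun j => avg b (f j)))//.
apply: (@mean_approx _ _ _ db J
  (fun j => negbin R r j * gap R d (r.+1 + j) * t ^+ j) (fun j x => x ^+ j)).
- apply: (@bounded01_sum _ J (fun j x => negbin R r j.+1 * t ^+ j * avg b (f j) x)).
  by move=> j _; exact: bounded01Z.
- by move=> j; exact: bounded01_X.
move=> x x01; have /andP[tx0 txt] := tx_le db x01; rewrite -/t in tx0 txt.
pose F w : R := (d%:R + w) ^- r.+1.
have h1 : `|F (1 + t * x) - F (t * x)
    - \sum_(j < J) negbin R r j.+1 * t ^+ j * avg b (f j) x| <= C * t ^+ J.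
  apply: (telescope_approx db (beta := fun j => negbin R r j.+1)) => // w w0.
  have := HC (d%:R + w) t; rewrite big_ord_recl/= negbin_r0 addn0 mul1r expr0 mulr1.
  rewrite opprD addrA => /(_ _ (ltW t0)).
  rewrite /F /f; under [X in _ - X]eq_bigr do rewrite /bump/= add1n addnS mulrAC.
  by rewrite addrA; apply; rewrite (le_trans d1)// lerDl.
have tJ : D * (t * x) ^+ J <= D * t ^+ J.
  by rewrite ler_wpM2l// lerXn2r ?nnegrE// ltW.
have h2 := le_trans (HD (d%:R + 1) (t * x) (le_trans d1 _) tx0) tJ.
have h3 := le_trans (HD d%:R (t * x) d1 tx0) tJ.
rewrite -addrA -/(F (1 + t * x)) in h2.
have {}h2 := h2 ltac:(by rewrite lerDl).
have := norm_sub3 h1 h2 h3.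
rewrite -/(F (t * x)) -!mulrDl; congr (`|_| <= _).
set S := \sum_(j < J) negbin R r j.+1 * _ * _.
have -> : \sum_(j < J) negbin R r j * gap R d (r.+1 + j) * t ^+ j * x ^+ j =
    \sum_(j < J) negbin R r j * (d%:R + 1) ^- (r.+1 + j) * (t * x) ^+ j
    - \sum_(j < J) negbin R r j * d%:R ^- (r.+1 + j) * (t * x) ^+ j.
  by rewrite -sumrB; apply: eq_bigr => j _; rewrite exprMn /gap; ring.
by ring.
Qed.

(** The telescoping sum for log(d+w); it is the only relation that involves
    G_1, and it produces the logarithm of the main term. *)
Lemma momG_log_rel J : exists2 C : R, 0 <= C & forall b, (d < b)%N ->
  `|\sum_(j < J) (-1) ^+ j / j.+1%:R * b%:R^-1 ^+ j * momG R d j.+1 b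
    - ln (1 + d%:R^-1)
    - \sum_(j < J) (-1) ^+ j / j.+1%:R * gap R d j.+1 * b%:R^-1 ^+ j.+1
        * momU R d j.+1 b|
    <= C * b%:R^-1 ^+ J.
Proof.
exists 3 => // b db; have t0 := t_gt0 db; have t1 := t_le1 db.
set t := b%:R^-1 in t0 t1 *.
pose f (j : nat) (w : R) := (d%:R + w) ^- j.+1.
have bf j : bounded01 (avg b (f j)).
  by apply: (bounded01_avg db); exact: bounded01_dV.
rewrite -(@mean_lin_comb _ _ _ db J (fun j => (-1) ^+ j / j.+1%:R * t ^+ j)
  (fun j => avg b (f j)))//.
pose A x := \sum_(j < J) (-1) ^+ j / j.+1%:R * t ^+ j * avg b (f j) x.
have bA : bounded01 A.
  apply: (@bounded01_sum _ J (fun j x => (-1) ^+ j / j.+1%:R * t ^+ j * avg b (f j) x)).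
  by move=> j _; exact: bounded01Z.
have bl : bounded01 (fun=> ln (1 + d%:R^-1) : R) := bounded01_cst _.
rewrite -[ln _](mean_cst db) -meanB//.
apply: (@mean_approx _ _ _ db J
  (fun j => (-1) ^+ j / j.+1%:R * gap R d j.+1 * t ^+ j.+1) (fun j x => x ^+ j.+1)).
- exact: bounded01B.
- by move=> j; exact: bounded01_X.
move=> x x01; have /andP[tx0 txt] := tx_le db x01; rewrite -/t in tx0 txt.
pose F w : R := ln (d%:R + w).
have h1 : `|F (1 + t * x) - F (t * x) - A x| <= 1 * t ^+ J.
  apply: (telescope_approx db (beta := fun j => (-1) ^+ j / j.+1%:R)) => // w w0.
  have dw : 1 <= d%:R + w by rewrite (le_trans d1)// lerDl.
  have := ln_taylor_scaled J dw (ltW t0); rewrite mul1r /F /f addrA.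
  by under [X in _ - X]eq_bigr do rewrite mulrAC.
have tJ : (t * x) ^+ J.+1 <= t ^+ J.
  apply: (@le_trans _ _ (t ^+ J.+1)); first by rewrite lerXn2r ?nnegrE// ltW.
  by rewrite exprS ler_piMl// exprn_ge0// ltW.
have d2 : 1 <= d%:R + 1 :> R by rewrite (le_trans d1)// lerDl.
have h2 := le_trans (ln_taylor_scaled J d2 tx0) tJ.
have h3 := le_trans (ln_taylor_scaled J d1 tx0) tJ.
have := norm_sub3 h1 h2 h3.
have -> : 1 * t ^+ J + t ^+ J + t ^+ J = 3 * t ^+ J by ring.
rewrite -[d%:R + 1 + t * x]addrA -/(F (1 + t * x)) -/(F (t * x)); congr (`|_| <= _).
have -> : \sum_(j < J) (-1) ^+ j / j.+1%:R * gap R d j.+1 * t ^+ j.+1 * x ^+ j.+1 =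
    \sum_(j < J) (-1) ^+ j / j.+1%:R * (d%:R + 1) ^- j.+1 * (t * x) ^+ j.+1
    - \sum_(j < J) (-1) ^+ j / j.+1%:R * d%:R ^- j.+1 * (t * x) ^+ j.+1.
  by rewrite -sumrB; apply: eq_bigr => j _; rewrite exprMn /gap; ring.
have -> : ln (1 + d%:R^-1) = ln (d%:R + 1) - ln d%:R :> R.
  have d0 : 0 < d%:R :> R by rewrite (lt_le_trans _ d1)// ltr01.
  rewrite -ln_div ?posrE ?addr_gt0//; congr ln.
  by rewrite mulrDl mulfV ?gt_eqF// mul1r.
rewrite /A; ring.
Qed.

End relations.

(** * The Kempner sum in terms of moments *)

Section kempner_relation.
Variables (R : realType) (d : nat).
Hypothesis d_gt0 : (0 < d)%N.
Implicit Types (b : nat) (x : R).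

Let d1 : 1 <= d%:R :> R. Proof. by rewrite ler1n. Qed.
Let d0 : 0 < d%:R :> R. Proof. by rewrite ltr0n. Qed.

(** The Kempner sum minus its main term. *)
Definition kempner_corr b : R :=
  kempner R b d - (b%:R * ln b%:R - b%:R * ln (1 + d%:R^-1)).

Lemma norm_momU_le1 j b : (d < b)%N -> `|momU R d j b| <= 1.
Proof.
move=> db; apply: norm_mean_le => // x /andP[x0 x1].
by rewrite ger0_norm ?exprn_ge0// exprn_ile1.
Qed.

(** The contribution of the digit d to the fixed-point equation for 1/(d+x),
    expanded in powers of (d+x)/b. *)
Lemma mean_inv_rel J : exists2 C : R, 0 <= C & forall b, (d < b)%N ->
  `|mean b d (fun x => (d%:R + (d%:R + x) / b%:R)^-1) - d%:R^-1
    + \sum_(j < J) (-1) ^+ j * d%:R ^- j.+2 * b%:R^-1 ^+ j.+1 * momV R d j.+1 b|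
  <= C * b%:R^-1 ^+ J.+1.
Proof.
have [C C0 HC] := inv_pow_taylor_scaled R 0 J.+1.
exists (C * (d%:R + 1) ^+ J.+1); first by rewrite mulr_ge0// exprn_ge0.
move=> b db; have t0 : 0 < b%:R^-1 :> R.
  by rewrite invr_gt0 ltr0n (leq_trans _ db).
set t := b%:R^-1 in t0 *.
have bnd : bounded01 (fun x => (d%:R + (d%:R + x) / b%:R)^-1).
  have [c Hc] := bounded01_inv R d_gt0; exists c => x x01.
  by apply: Hc; exact: (digit01 db db).
have app : `|mean b d (fun x => (d%:R + (d%:R + x) / b%:R)^-1)
  - \sum_(j < J.+1) (-1) ^+ j * d%:R ^- j.+1 * t ^+ j * momV R d j b|
  <= C * (d%:R + 1) ^+ J.+1 * t ^+ J.+1.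
  apply: (@mean_approx _ _ _ db J.+1 (fun j => (-1) ^+ j * d%:R ^- j.+1 * t ^+ j)
    (fun j x => (d%:R + x) ^+ j)) => //.
  - by move=> j; exact: bounded01_dX.
  move=> x x01; have /andP[x0 x1] := x01.
  have u0 : 0 <= (d%:R + x) / b%:R by have /andP[] := digit01 db db x01.
  have := HC d%:R _ d1 u0; rewrite expr1.
  have -> : \sum_(j < J.+1) negbin R 0 j * d%:R ^- (1 + j) * ((d%:R + x) / b%:R) ^+ j
    = \sum_(j < J.+1) (-1) ^+ j * d%:R ^- j.+1 * t ^+ j * (d%:R + x) ^+ j.
    apply: eq_bigr => j _; rewrite negbin0 add1n exprMn /t; ring.
  move=> /le_trans; apply; rewrite -mulrA ler_wpM2l// -exprMn.
  rewrite lerXn2r ?nnegrE//; first by rewrite mulr_ge0 ?addr_ge0 ?ltW.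
  by rewrite ler_wpM2r ?(ltW t0)// lerD2l.
move: app; rewrite big_ord_recl/= !expr0 expr1 mul1r mulr1.
have -> : momV R d 0 b = 1 by rewrite /momV -[RHS](mean_cst db).
rewrite mulr1 opprD addrA; congr (`|_ + _| <= _).
rewrite -sumrN; apply: eq_bigr => j _; rewrite /bump/= add1n [(-1) ^+ j.+1]exprS.
by rewrite mulN1r !mulNr opprK.
Qed.

Lemma mean_digam_rel J : exists2 C : R, 0 <= C & forall b, (d < b)%N ->
  `|mean b d (fun x => digam ((d%:R + x) / b%:R))
    - \sum_(j < J) (-1) ^+ j * zeta (j.+2)%:R * b%:R^-1 ^+ j.+1 * momV R d j.+1 b|
  <= C * b%:R^-1 ^+ J.+1.
Proof.
have z0 : 0 <= zeta 2 :> R.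
  by have := digam_taylor 0 (@ler01 R); rewrite expr1 mulr1; exact: le_trans.
exists (zeta 2 * (d%:R + 1) ^+ J.+1); first by rewrite mulr_ge0// exprn_ge0.
move=> b db; have t0 : 0 < b%:R^-1 :> R.
  by rewrite invr_gt0 ltr0n (leq_trans _ db).
set t := b%:R^-1 in t0 *.
apply: (@mean_approx _ _ _ db J (fun j => (-1) ^+ j * zeta (j.+2)%:R * t ^+ j.+1)
    (fun j x => (d%:R + x) ^+ j.+1)) => //.
- have [c Hc] := bounded01_digam R; exists c => x x01.
  by apply: Hc; exact: (digit01 db db).
- by move=> j; exact: bounded01_dX.
move=> x x01; have /andP[x0 x1] := x01.
have u0 : 0 <= (d%:R + x) / b%:R by have /andP[] := digit01 db db x01.
have := digam_taylor J u0.
have -> : \sum_(j < J) (-1) ^+ j * zeta j.+2%:R * ((d%:R + x) / b%:R) ^+ j.+1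
  = \sum_(j < J) (-1) ^+ j * zeta j.+2%:R * t ^+ j.+1 * (d%:R + x) ^+ j.+1.
  apply: eq_bigr => j _; rewrite exprMn /t; ring.
move=> /le_trans; apply; rewrite -mulrA ler_wpM2l// -exprMn.
rewrite lerXn2r ?nnegrE//; first by rewrite mulr_ge0 ?addr_ge0 ?ltW.
by rewrite ler_wpM2r ?(ltW t0)// lerD2l.
Qed.

Lemma kempner_rel J : exists2 C : R, 0 <= C & forall b, (d < b)%N ->
  `|kempner_corr b
    + \sum_(j < J) (-1) ^+ j / j.+2%:R * b%:R^-1 ^+ j * momG R d j.+2 b
    + \sum_(j < J) (-1) ^+ j / j.+1%:R * gap R d j.+1 * b%:R^-1 ^+ j * momU R d j.+1 b
    - \sum_(j < J) (-1) ^+ j * (zeta (j.+2)%:R - d%:R ^- j.+2)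
        * b%:R^-1 ^+ j.+1 * momV R d j.+1 b|
  <= C * b%:R^-1 ^+ J.
Proof.
have [C1 C10 H1] := momG_log_rel R d_gt0 J.+1.
have [C3 C30 H3] := mean_inv_rel J.
have [C4 C40 H4] := mean_digam_rel J.
exists (C1 + `|gap R d J.+1| + C3 + C4); first by rewrite !addr_ge0.
move=> b db.
have t0 : 0 < b%:R^-1 :> R by rewrite invr_gt0 ltr0n (leq_trans _ db).
have b0 : 0 < b%:R :> R by rewrite -invr_gt0.
have t1 : b%:R^-1 <= 1 :> R by rewrite invf_le1// ler1n (leq_trans _ db).
move: (H1 _ db) (H3 _ db) (H4 _ db) => {H1 H3 H4}.
have Kb : kempner_corr b = b%:R * ln (1 + d%:R^-1) - d%:R^-1 - b%:R * momG R d 1 b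
    + mean b d (fun x => (d%:R + (d%:R + x) / b%:R)^-1)
    + mean b d (fun x => digam ((d%:R + x) / b%:R)).
  rewrite /kempner_corr (kempner_digam R d_gt0 db).
  rewrite [mean b d (fun x => (d%:R + x)^-1)](mean_eq db); last exact: bounded01_inv.
  rewrite addr0 (_ : mean b d (avg b (fun x => (d%:R + x)^-1)) = momG R d 1 b)//.
  by field; rewrite !gt_eqF.
set t := b%:R^-1 in t0 t1 *.
move: Kb; set M3 := mean b d (fun x => (_ + _)^-1).
set M4 := mean b d (fun x => digam _) => Kb.
set S3 := \sum_(j < J) _; set S4 := \sum_(j < J) _.
set L := ln _ in Kb *.
set A1 := \sum_(j < J.+1) _; set B1 := \sum_(j < J.+1) _.
move=> H1 H3 H4.
set SG := \sum_(j < J) _; set SU := \sum_(j < J) _; set SV := \sum_(j < J) _.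
(* The last term of B1 times b, which is absorbed in the error. *)
pose e := (-1) ^+ J / J.+1%:R * gap R d J.+1 * t ^+ J * momU R d J.+1 b.
have eA : b%:R * A1 = b%:R * momG R d 1 b - SG.
  rewrite /A1 big_ord_recl/= !expr0 mul1r invr1 !mul1r mulrDr; congr (_ + _).
  rewrite mulr_sumr -sumrN; apply: eq_bigr => j _; rewrite /bump/= !add1n.
  rewrite exprS [t ^+ j.+1]exprS /t; field; rewrite ?gt_eqF//.
have eB : b%:R * B1 = SU + e.
  rewrite /B1 mulr_sumr big_ord_recr/=; congr (_ + _).
    by apply: eq_bigr => j _; rewrite [t ^+ j.+1]exprS /t; field; rewrite ?gt_eqF.
  rewrite /e [t ^+ J.+1]exprS.
  rewrite (_ : b%:R * _ = (b%:R * t) * ((-1) ^+ J / J.+1%:R * gap R d J.+1 * t ^+ J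
    * momU R d J.+1 b)); last by ring.
  by rewrite mulfV ?gt_eqF// mul1r.
have eV : SV = S4 - S3.
  by rewrite /SV /S4 /S3 -sumrB; apply: eq_bigr => j _; ring.
have -> : kempner_corr b + SG + SU - SV =
    - (b%:R * (A1 - L - B1)) - e + (M3 - d%:R^-1 + S3) + (M4 - S4).
  by rewrite Kb !mulrBr eA eB eV; ring.
have tJ : t ^+ J.+1 <= t ^+ J by rewrite exprS ler_piMl// exprn_ge0// ltW.
rewrite (le_trans (ler_normD _ _))// !mulrDl lerD//; last first.
  by rewrite (le_trans H4)// ler_wpM2l.
rewrite (le_trans (ler_normD _ _))// lerD//; last first.
  by rewrite (le_trans H3)// ler_wpM2l.
rewrite (le_trans (ler_normB _ _))// lerD//.
  rewrite normrN normrM (gtr0_norm b0).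
  by rewrite mulrC -ler_pdivlMr// -mulrA -/t -exprSr.
have := norm_momU_le1 J.+1 db; rewrite /e.
move: (momU R d J.+1 b) => m m1.
rewrite !normrM !normrX normrN normr1 expr1n mul1r (gtr0_norm t0).
have J1 : `|J.+1%:R^-1| <= 1 :> R.
  by rewrite ger0_norm ?invr_ge0// invf_le1// ler1n.
rewrite -[leRHS]mulr1 ler_pM ?mulr_ge0 ?exprn_ge0 ?(ltW t0)//.
by rewrite ler_wpM2r ?exprn_ge0 ?(ltW t0)// ler_piMl.
Qed.

End kempner_relation.

(** * Expansions in inverse powers of the base *)

Section expansions.
Variable R : realType.
Implicit Types (f g h : nat -> R) (a : nat -> R) (n k : nat).

(** g(b) = O(b^(-n)) as b tends to infinity. *)
Definition bigOinv n g := exists C : R,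
  \forall b \near \oo, `|g b| <= C * b%:R^-1 ^+ n.

(** g has the expansion with coefficients a up to the error O(b^(-n)); only
    the coefficients a_i with i < n are relevant. *)
Definition expands n g a := bigOinv n (fun b => g b - \sum_(i < n) a i * b%:R^-1 ^+ i).

(** The coefficients of t^k * g, when a are those of g. *)
Definition shift k a i : R := if (i < k)%N then 0 else a (i - k)%N.

Let inv_ge0 b : 0 <= b%:R^-1 :> R. Proof. by rewrite invr_ge0. Qed.

Let inv_le1 : \forall b \near \oo, b%:R^-1 <= 1 :> R.
Proof. by near=> b; rewrite invf_le1 ?ler1n ?ltr0n; near: b; exact: nbhs_infty_gt.
Unshelve. all: by end_near. Qed.

Lemma bigOinv_lin n f g (c : R) : bigOinv n f -> bigOinv n g ->
  bigOinv n (fun b => f b + c * g b).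
Proof.
move=> [C HC] [D HD]; exists (C + `|c| * D); near=> b.
rewrite (le_trans (ler_normD _ _))// mulrDl lerD//.
  by near: b.
by rewrite normrM -mulrA ler_wpM2l//; near: b.
Unshelve. all: by end_near. Qed.

Lemma bigOinv_near n f g : (\forall b \near \oo, f b = g b) ->
  bigOinv n f -> bigOinv n g.
Proof.
move=> fg [C HC]; exists C; near=> b.
rewrite -(_ : f b = g b); last by near: b.
by near: b.
Unshelve. all: by end_near. Qed.

Lemma bigOinv_le m n g : (m <= n)%N -> bigOinv n g -> bigOinv m g.
Proof.
move=> mn [C HC]; exists `|C|; near=> b.
have b1 : b%:R^-1 <= 1 :> R by near: b; exact: inv_le1.
have : `|g b| <= C * b%:R^-1 ^+ n by near: b.
move=> /le_trans; apply; apply: (@le_trans _ _ (`|C| * b%:R^-1 ^+ n)).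
  by rewrite ler_wpM2r ?exprn_ge0// ler_norm.
by rewrite ler_wpM2l// ler_wiXn2l.
Unshelve. all: by end_near. Qed.

Lemma bigOinv_mulX k n g : bigOinv n g ->
  bigOinv (n + k) (fun b => b%:R^-1 ^+ k * g b).
Proof.
move=> [C HC]; exists C; near=> b.
rewrite normrM ger0_norm ?exprn_ge0// exprD mulrA mulrC ler_wpM2r ?exprn_ge0//.
by near: b.
Unshelve. all: by end_near. Qed.

Lemma bigOinvX n k (c : R) : (n <= k)%N -> bigOinv n (fun b => c * b%:R^-1 ^+ k).
Proof.
move=> nk; apply: (bigOinv_le nk); exists `|c|.
by near=> b; rewrite normrM [X in _ * X]ger0_norm// exprn_ge0.
Unshelve. all: by end_near. Qed.

Lemma expands_near n f g a : (\forall b \near \oo, f b = g b) ->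
  expands n f a -> expands n g a.
Proof.
move=> fg; apply: bigOinv_near; near=> b.
by rewrite (_ : f b = g b)//; near: b.
Unshelve. all: by end_near. Qed.

Lemma expands_lin n f g a a' (c : R) : expands n f a -> expands n g a' ->
  expands n (fun b => f b + c * g b) (fun i => a i + c * a' i).
Proof.
move=> ef eg; apply: bigOinv_near (bigOinv_lin c ef eg); apply: nearW => b.
rewrite mulrBr mulr_sumr addrACA -opprD -big_split/=; congr (_ - _).
by apply: eq_bigr => i _; rewrite mulrDl mulrA.
Qed.

Lemma expands_bigO n f g a : expands n f a -> bigOinv n (fun b => g b - f b) ->
  expands n g a.
Proof.
move=> ef gf; apply: bigOinv_near (bigOinv_lin 1 ef gf); apply: nearW => b.
by ring.
Qed.

Lemma expands_cst n (c : R) : expands n (fun=> c) (fun i => c *+ (i == 0)%N).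
Proof.
case: n => [|n].
  by exists `|c|; near=> b; rewrite big_ord0 subr0 expr0 mulr1.
exists 0; near=> b; rewrite big_ord_recl/= expr0 mulr1 big1 ?addr0 ?subrr ?normr0 ?mul0r//.
by move=> i _; rewrite mul0r.
Unshelve. all: by end_near. Qed.

Lemma expandsZ n g a (c : R) : expands n g a ->
  expands n (fun b => c * g b) (fun i => c * a i).
Proof.
move=> eg; have := expands_lin c (expands_cst n 0) eg.
have -> : (fun i => 0 *+ (i == 0) + c * a i) = (fun i => c * a i).
  by apply/funext => i; rewrite mul0rn add0r.
by apply: expands_near; apply: nearW => b; rewrite add0r.
Qed.

Lemma expandsD n f g a a' : expands n f a -> expands n g a' ->
  expands n (fun b => f b + g b) (fun i => a i + a' i).
Proof.
move=> ef eg; have := expands_lin 1 ef eg.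
have -> : (fun i => a i + 1 * a' i) = (fun i => a i + a' i).
  by apply/funext => i; rewrite mul1r.
by apply: expands_near; apply: nearW => b; rewrite mul1r.
Qed.

Lemma expandsB n f g a a' : expands n f a -> expands n g a' ->
  expands n (fun b => f b - g b) (fun i => a i - a' i).
Proof.
move=> ef eg; have := expands_lin (-1) ef eg.
have -> : (fun i => a i + -1 * a' i) = (fun i => a i - a' i).
  by apply/funext => i; rewrite mulN1r.
by apply: expands_near; apply: nearW => b; rewrite mulN1r.
Qed.

Lemma expands_sum n J (F A : nat -> nat -> R) :
  (forall j, (j < J)%N -> expands n (F j) (A j)) ->
  expands n (fun b => \sum_(j < J) F j b) (fun i => \sum_(j < J) A j i).
Proof.
elim: J => [|J IH] H.
  have := expands_cst n 0.
  have -> : (fun i => 0 *+ (i == 0)) = (fun i => \sum_(j < 0) A j i).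
    by apply/funext => i; rewrite mul0rn big_ord0.
  by apply: expands_near; apply: nearW => b; rewrite big_ord0.
have := expandsD (IH (fun j Hj => H j (ltnW Hj))) (H J (ltnSn J)).
have -> : (fun i => \sum_(j < J) A j i + A J i) = (fun i => \sum_(j < J.+1) A j i).
  by apply/funext => i; rewrite big_ord_recr.
by apply: expands_near; apply: nearW => b; rewrite big_ord_recr.
Qed.

Lemma expands_trunc m n g a : (m <= n)%N -> expands n g a -> expands m g a.
Proof.
move=> mn eg.
have sum_tail : bigOinv m (fun b => \sum_(m <= i < n) a i * b%:R^-1 ^+ i).
  elim: n mn {eg} => [|n IH] mn.
    exists 0; near=> b; move: mn; rewrite leqn0 => /eqP ->.
    by rewrite big_geq// normr0 mul0r.
  move: mn; rewrite leq_eqVlt ltnS => /predU1P[<-|mn].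
    by exists 0; near=> b; rewrite big_geq// normr0 mul0r.
  have := bigOinv_lin 1 (IH mn) (bigOinvX (a n) mn).
  by apply: bigOinv_near; apply: nearW => b; rewrite big_nat_recr//= mul1r.
have := bigOinv_lin 1 (bigOinv_le mn eg) sum_tail.
apply: bigOinv_near; apply: nearW => b.
rewrite -[\sum_(i < n) _](big_mkord xpredT (fun i => a i * b%:R^-1 ^+ i)).
rewrite (@big_cat_nat _ _ _ m 0 n)//= big_mkord.
by ring.
Unshelve. all: by end_near. Qed.

Lemma expands_shift k n g a : expands n g a ->
  expands (n + k) (fun b => b%:R^-1 ^+ k * g b) (shift k a).
Proof.
move=> eg; have := bigOinv_mulX k eg.
apply: bigOinv_near; apply: nearW => b; rewrite mulrBr; congr (_ - _).
rewrite addnC big_split_ord/= [X in _ = X + _]big1 ?add0r.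
  rewrite mulr_sumr; apply: eq_bigr => i _.
  by rewrite /shift ltnNge leq_addr/= addKn exprD mulrCA.
by move=> i _; rewrite /shift ltn_ord mul0r.
Qed.

(** By induction on i: the first nonzero coefficient of the difference would
    dominate the remainder. *)
Lemma expands_unique n g a a' : expands n g a -> expands n g a' ->
  forall i, (i < n)%N -> a i = a' i.
Proof.
move=> ea ea'; pose c i := a i - a' i.
suff H : forall i, (i < n)%N -> c i = 0.
  by move=> i /H /eqP; rewrite subr_eq0 => /eqP.
have cO : bigOinv n (fun b => \sum_(i < n) c i * b%:R^-1 ^+ i).
  have := bigOinv_lin (-1) ea' ea; apply: bigOinv_near; apply: nearW => b.
  under [RHS]eq_bigr do rewrite mulrBl.
  by rewrite sumrB; ring.
elim/ltn_ind => i IH iN.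
have [C HC] : bigOinv i.+1 (fun b => c i * b%:R^-1 ^+ i).
  have /(expands_trunc iN) : expands n (fun b => \sum_(i < n) c i * b%:R^-1 ^+ i) c.
    by exists 0; near=> b; rewrite subrr normr0 mul0r.
  move=> /(bigOinv_lin (-1) (bigOinv_le iN cO)).
  apply: bigOinv_near; apply: nearW => b.
  rewrite [\sum_(j < i.+1) _]big_ord_recr/= [X in _ - (X + _)]big1; first by ring.
  by move=> j _; rewrite IH ?mul0r// (ltn_trans _ iN).
apply/eqP; apply: contraT => ci0.
near \oo => b.
have b0 : 0 < b%:R :> R by rewrite ltr0n; near: b; exact: nbhs_infty_gt.
have : `|c i * b%:R^-1 ^+ i| <= C * b%:R^-1 ^+ i.+1 by near: b.
have bC : C / `|c i| < b%:R by near: b; exact: nbhs_infty_gtr.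
rewrite normrM (@ger0_norm _ (_ ^+ _)) ?exprn_ge0// exprS mulrA.
rewrite ler_pM2r ?exprn_gt0 ?invr_gt0// ler_pdivlMr// mulrC -ler_pdivlMr ?normr_gt0//.
by rewrite leNgt bC.
Unshelve. all: by end_near.
Qed.

Definition has_expansion n g := exists a, expands n g a.

(** Expansions to all finite orders are restrictions of a single sequence, by
    uniqueness of the coefficients. *)
Lemma full_expansion g : (forall n, has_expansion n g) ->
  exists a, forall n, expands n g a.
Proof.
move=> H; have {H} [A HA] := choice H.
exists (fun i => A i.+1 i) => n.
have := HA n; apply: bigOinv_near; apply: nearW => b; congr (_ - _).
apply: eq_bigr => i _; congr (_ * _).
have in_ := ltn_ord i.
exact: (expands_unique (expands_trunc in_ (HA n)) (HA i.+1)).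
Qed.

Lemma has_expansion_near n f g : (\forall b \near \oo, f b = g b) ->
  has_expansion n f -> has_expansion n g.
Proof. by move=> fg [a]; exists a; exact: expands_near fg _. Qed.

Lemma has_expansionZ n g c : has_expansion n g -> has_expansion n (fun b => c * g b).
Proof. by move=> [a /(expandsZ c)]; eexists; eassumption. Qed.

Lemma has_expansionD n f g : has_expansion n f -> has_expansion n g ->
  has_expansion n (fun b => f b + g b).
Proof. by move=> [a ea] [a' ea']; eexists; exact: expandsD ea ea'. Qed.

Lemma has_expansionB n f g : has_expansion n f -> has_expansion n g ->
  has_expansion n (fun b => f b - g b).
Proof. by move=> [a ea] [a' ea']; eexists; exact: expandsB ea ea'. Qed.

Lemma has_expansion_cst n c : has_expansion n (fun=> c).
Proof. by eexists; exact: expands_cst. Qed.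

Lemma has_expansion_sum n J (F : nat -> nat -> R) :
  (forall j, (j < J)%N -> has_expansion n (F j)) ->
  has_expansion n (fun b => \sum_(j < J) F j b).
Proof.
elim: J => [|J IH] H.
  by apply: has_expansion_near (has_expansion_cst n 0); apply: nearW => b; rewrite big_ord0.
have := has_expansionD (IH (fun j Hj => H j (ltnW Hj))) (H J (ltnSn J)).
by apply: has_expansion_near; apply: nearW => b; rewrite big_ord_recr.
Qed.

Lemma has_expansion_mulX k m n g : (m <= n + k)%N -> has_expansion n g ->
  has_expansion m (fun b => b%:R^-1 ^+ k * g b).
Proof.
by move=> mn [a /(expands_shift k)/(expands_trunc mn)]; eexists; eassumption.
Qed.

Lemma has_expansion_bigO n f g : has_expansion n f ->
  bigOinv n (fun b => g b - f b) -> has_expansion n g.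
Proof. by move=> [a ea] gf; exists a; exact: expands_bigO ea gf. Qed.

Lemma has_expansion0 (C : R) g : (\forall b \near \oo, `|g b| <= C) ->
  has_expansion 0 g.
Proof.
move=> HC; exists (fun=> 0); exists C; near=> b.
by rewrite big_ord0 subr0 expr0 mulr1; near: b.
Unshelve. all: by end_near. Qed.

End expansions.

(** * Existence of expansions *)

Section existence.
Variables (R : realType) (d : nat).
Hypothesis d_gt0 : (0 < d)%N.
Implicit Types (j n r : nat).

Let near_db : \forall b \near \oo, (d < b)%N.
Proof. exact: nbhs_infty_gt. Qed.

Lemma bigOinv_db n (g : nat -> R) :
  (exists2 C : R, 0 <= C & forall b, (d < b)%N -> `|g b| <= C * b%:R^-1 ^+ n) ->
  bigOinv n g.
Proof.
by move=> [C _ HC]; exists C; near=> b; apply: HC; near: b.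
Unshelve. all: by end_near. Qed.

Lemma momU0 : \forall b \near \oo, momU R d 0 b = 1.
Proof.
by near=> b; rewrite /momU -[RHS](@mean_cst R b d)//; near: b.
Unshelve. all: by end_near. Qed.

(** The recurrence [momE_rec] solved for E_j. On the right, all the moments
    but U_0 = 1 are multiplied by a positive power of t. *)
Lemma momE_solved j : \forall b \near \oo, momE R d j b = j.+1%:R^-1 *
  (\sum_(i < j.+1) 'C(j.+1, i)%:R * (b%:R^-1 ^+ i * momU R d i b)
   - \sum_(i < j) 'C(j.+1, i)%:R * (b%:R^-1 ^+ (j - i) * momE R d i b)).
Proof.
near=> b; have db : (d < b)%N by near: b.
have := momE_rec R db j; rewrite [in LHS]big_ord_recr/= subnn expr0 mulr1 binSn.
move=> e.
have -> : \sum_(i < j.+1) 'C(j.+1, i)%:R * (b%:R^-1 ^+ i * momU R d i b)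
  = \sum_(i < j.+1) 'C(j.+1, i)%:R * b%:R^-1 ^+ i * momU R d i b.
  by apply: eq_bigr => i _; rewrite mulrA.
rewrite -e (_ : \sum_(i < j) 'C(j.+1, i)%:R * (b%:R^-1 ^+ (j - i) * momE R d i b)
  = \sum_(i < j) 'C(j.+1, i)%:R * b%:R^-1 ^+ (j - i) * momE R d i b); last first.
  by apply: eq_bigr => i _; rewrite mulrA.
by rewrite addrAC subrr add0r mulKf// pnatr_eq0.
Unshelve. all: by end_near. Qed.

Lemma momV_near j : \forall b \near \oo,
  momV R d j b = \sum_(i < j.+1) d%:R ^+ (j - i) *+ 'C(j, i) * momU R d i b.
Proof. by near=> b; apply: momV_sum; near: b.
Unshelve. all: by end_near. Qed.

Lemma momU_near j : \forall b \near \oo, momU R d j b =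
  b%:R^-1 * 0 ^+ j + momE R d j b - b%:R^-1 ^+ j.+1 * momV R d j b.
Proof. by near=> b; apply: momU_recE => //; near: b.
Unshelve. all: by end_near. Qed.

Lemma near_sym (f g : nat -> R) :
  (\forall b \near \oo, f b = g b) -> \forall b \near \oo, g b = f b.
Proof. by apply: filterS => b ->. Qed.

(** By bootstrap: an expansion of all the moments to order n gives one to
    order n + 1, since the recurrences involve them, apart from U_0 = 1, only
    with positive powers of t. *)
Lemma has_expansion_moments n :
  (forall j, has_expansion n (momU R d j)) /\ (forall j, has_expansion n (momE R d j)).
Proof.
elim: n => [|n [HU HE]].
  split=> j; apply: (@has_expansion0 _ 1); near=> b; have db : (d < b)%N by near: b.
    by apply: norm_momU_le1.
  apply: (norm_mean_le db); apply: (norm_avg_le db) => x /andP[x0 x1].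
  by rewrite ger0_norm ?exprn_ge0// exprn_ile1.
have HE1 j : has_expansion n.+1 (momE R d j).
  apply: has_expansion_near (near_sym (momE_solved j)) _.
  apply: has_expansionZ; apply: has_expansionB.
    apply: (@has_expansion_sum R n.+1 j.+1
      (fun i b => 'C(j.+1, i)%:R * (b%:R^-1 ^+ i * momU R d i b))) => -[_|i _].
      apply: has_expansionZ; apply: has_expansion_near (has_expansion_cst n.+1 1).
      by apply: near_sym; apply: filterS momU0 => b ->; rewrite mulr1.
    apply: has_expansionZ; apply: has_expansion_mulX (HU _).
    by rewrite addnS ltnS leq_addr.
  apply: (@has_expansion_sum R n.+1 j
    (fun i b => 'C(j.+1, i)%:R * (b%:R^-1 ^+ (j - i) * momE R d i b))) => i ij.
  apply: has_expansionZ; apply: has_expansion_mulX (HE _).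
  by rewrite -addn1 leq_add2l subn_gt0.
split=> // j.
apply: has_expansion_near (near_sym (momU_near j)) _.
apply: has_expansionB; first apply: has_expansionD => //.
  have -> : (fun b => b%:R^-1 * 0 ^+ j) = (fun b : nat => b%:R^-1 ^+ 1 * 0 ^+ j) :> (nat -> R).
    by [].
  by apply: has_expansion_mulX (has_expansion_cst n _); rewrite addn1.
apply: (@has_expansion_mulX _ _ _ n); first by rewrite addnS ltnS leq_addr.
apply: has_expansion_near (near_sym (momV_near j)) _.
apply: (@has_expansion_sum R n j.+1
    (fun i b => d%:R ^+ (j - i) *+ 'C(j, i) * momU R d i b)) => i _.
exact: has_expansionZ.
Unshelve. all: by end_near. Qed.

Lemma has_expansion_momU n j : has_expansion n (momU R d j).
Proof. by have [] := has_expansion_moments n. Qed.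

Lemma has_expansion_momE n j : has_expansion n (momE R d j).
Proof. by have [] := has_expansion_moments n. Qed.

Lemma has_expansion_momV n j : has_expansion n (momV R d j).
Proof.
apply: has_expansion_near (near_sym (momV_near j)) _.
apply: (@has_expansion_sum R n j.+1
    (fun i b => d%:R ^+ (j - i) *+ 'C(j, i) * momU R d i b)) => i _.
exact/has_expansionZ/has_expansion_momU.
Qed.

(** The same bootstrap, with [momG_rel] solved for its first term -(r+1)
    G_(r+2). *)
Lemma has_expansion_momG n r : has_expansion n (momG R d r.+2).
Proof.
elim: n r => [|n IH] r.
  apply: (@has_expansion0 _ 1); near=> b; have db : (d < b)%N by near: b.
  apply: (norm_mean_le db); apply: (norm_avg_le db) => x /andP[x0 x1].
  have c1 : 1 <= d%:R + x by rewrite (le_trans (_ : 1 <= d%:R)) ?ler1n// lerDl.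
  have c0 := lt_le_trans (@ltr01 R) c1.
  by rewrite gtr0_norm ?invr_gt0 ?exprn_gt0// invf_le1 ?exprn_gt0// exprn_ege1.
pose A b := \sum_(j < n) negbin R r j.+2 * (b%:R^-1 ^+ j.+1 * momG R d (r + j.+1).+2 b).
pose B b := \sum_(j < n.+1) negbin R r j * gap R d (r.+1 + j) * (b%:R^-1 ^+ j * momU R d j b).
have hA : has_expansion n.+1 A.
  apply: (@has_expansion_sum R n.+1 n (fun j b => negbin R r j.+2 *
    (b%:R^-1 ^+ j.+1 * momG R d (r + j.+1).+2 b))) => j _.
  apply: has_expansionZ; apply: has_expansion_mulX (IH _).
  by rewrite addnS ltnS leq_addr.
have hB : has_expansion n.+1 B.
  apply: (@has_expansion_sum R n.+1 n.+1 (fun j b => negbin R r j *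
    gap R d (r.+1 + j) * (b%:R^-1 ^+ j * momU R d j b))) => j _.
  apply: has_expansionZ; apply: (has_expansion_mulX (n := n.+1)).
    by rewrite leq_addr.
  exact: has_expansion_momU.
have r0 : r.+1%:R != 0 :> R by rewrite pnatr_eq0.
apply: has_expansion_bigO (has_expansionZ (r.+1%:R^-1) (has_expansionB hA hB)) _.
have := bigOinv_lin (- r.+1%:R^-1) (bigOinvX 0 (leqnn n.+1)) (bigOinv_db (momG_rel R d_gt0 r n.+1)).
apply: bigOinv_near; apply: nearW => b.
rewrite mul0r add0r big_ord_recl/= negbin1 expr0 mulr1 addn0.
set SB := \sum_(j < n.+1) _; set SA := \sum_(j < n) _.
have -> : SB = B b.
  by rewrite /SB /B; apply: eq_bigr => j _; rewrite [RHS]mulrA.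
have -> : SA = A b.
  rewrite /SA /A; apply: eq_bigr => j _.
  by rewrite /bump/= !add1n [RHS]mulrA !addSn.
by field.
Unshelve. all: by end_near. Qed.

Lemma has_expansion_kempner_corr n : has_expansion n (kempner_corr R d).
Proof.
pose A b := \sum_(j < n) (-1) ^+ j / j.+2%:R * (b%:R^-1 ^+ j * momG R d j.+2 b).
pose B b := \sum_(j < n) (-1) ^+ j / j.+1%:R * gap R d j.+1 *
  (b%:R^-1 ^+ j * momU R d j.+1 b).
pose D b := \sum_(j < n) (-1) ^+ j * (zeta j.+2%:R - d%:R ^- j.+2) *
  (b%:R^-1 ^+ j.+1 * momV R d j.+1 b).
have hA : has_expansion n A.
  apply: (@has_expansion_sum R n n (fun j b => (-1) ^+ j / j.+2%:R *
    (b%:R^-1 ^+ j * momG R d j.+2 b))) => j _.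
  apply: has_expansionZ; apply: (has_expansion_mulX (n := n)); rewrite ?leq_addr//.
  exact: has_expansion_momG.
have hB : has_expansion n B.
  apply: (@has_expansion_sum R n n (fun j b => (-1) ^+ j / j.+1%:R * gap R d j.+1 *
    (b%:R^-1 ^+ j * momU R d j.+1 b))) => j _.
  apply: has_expansionZ; apply: (has_expansion_mulX (n := n)); rewrite ?leq_addr//.
  exact: has_expansion_momU.
have hD : has_expansion n D.
  apply: (@has_expansion_sum R n n (fun j b => (-1) ^+ j *
    (zeta j.+2%:R - d%:R ^- j.+2) * (b%:R^-1 ^+ j.+1 * momV R d j.+1 b))) => j _.
  apply: has_expansionZ; apply: (has_expansion_mulX (n := n)); rewrite ?leq_addr//.
  exact: has_expansion_momV.
apply: has_expansion_bigO (has_expansionB (has_expansionB hD hA) hB) _.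
apply: bigOinv_near (bigOinv_db (kempner_rel R d_gt0 n)); apply: nearW => b.
set SG := \sum_(j < n) _; set SU := \sum_(j < n) _; set SV := \sum_(j < n) _.
have -> : SG = A b by rewrite /SG /A; apply: eq_bigr => j _; rewrite [RHS]mulrA.
have -> : SU = B b by rewrite /SU /B; apply: eq_bigr => j _; rewrite [RHS]mulrA.
have -> : SV = D b by rewrite /SV /D; apply: eq_bigr => j _; rewrite [RHS]mulrA.
by ring.
Qed.

End existence.

(** * Equations between the coefficients *)

(** The coefficients of V_j, which is a linear combination of U_0, ..., U_j. *)
Definition shifted_moment (R : realType) (D : R) (alpha : nat -> nat -> R)
    (j i : nat) : R :=
  \sum_(k < j.+1) 'C(j, k)%:R * D ^+ (j - k) * alpha k i.

Section coefficients.
Variables (R : realType) (d : nat).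
Hypothesis d_gt0 : (0 < d)%N.
(* alpha_j, eps_j, gamma_r and kappa are the coefficients of U_j, E_j, G_(r+2)
   and of the corrected Kempner sum. *)
Variables (alpha eps gamma : nat -> nat -> R) (kappa : nat -> R).
Hypothesis alphaP : forall j n, expands n (momU R d j) (alpha j).
Hypothesis epsP : forall j n, expands n (momE R d j) (eps j).
Hypothesis gammaP : forall r n, expands n (momG R d r.+2) (gamma r).
Hypothesis kappaP : forall n, expands n (kempner_corr R d) kappa.
Implicit Types (j n r : nat).

Local Notation nu := (shifted_moment d%:R alpha).

Let near_db : \forall b \near \oo, (d < b)%N.
Proof. exact: nbhs_infty_gt. Qed.

Lemma expands_momV j n : expands n (momV R d j) (nu j).
Proof.
apply: expands_near (@expands_sum R n j.+1
  (fun k b => 'C(j, k)%:R * d%:R ^+ (j - k) * momU R d k b)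
  (fun k i => 'C(j, k)%:R * d%:R ^+ (j - k) * alpha k i) _); last first.
  by move=> k _; apply: expandsZ.
near=> b; rewrite momV_sum; last by near: b.
by apply: eq_bigr => k _; rewrite mulr_natl.
Unshelve. all: by end_near. Qed.

Lemma momU_coef0 n : alpha 0 n = 1 *+ (n == 0)%N.
Proof.
apply: (expands_unique (n := n.+1) (alphaP 0 n.+1)
  (a' := fun n => 1 *+ (n == 0)%N)) => //.
by apply: expands_near (near_sym (momU0 R d)) _; exact: expands_cst.
Qed.

Lemma momU_coefS j n : alpha j.+1 n = eps j.+1 n - shift j.+2 (nu j.+1) n.
Proof.
apply: (expands_unique (n := n.+1) (alphaP j.+1 n.+1)
  (a' := fun n => eps j.+1 n - shift j.+2 (nu j.+1) n)) => //.
apply: expands_near (near_sym (momU_near R d j.+1)) _.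
apply: (expands_near _ (expandsB (epsP j.+1 n.+1)
  (expands_trunc (leq_addr _ _) (expands_shift j.+2 (expands_momV j.+1 n.+1))))).
by apply: nearW => b; rewrite expr0n mulr0 add0r.
Qed.

Lemma momE_coef_rec j n :
  \sum_(i < j.+1) 'C(j.+1, i)%:R * shift (j - i) (eps i) n =
  \sum_(i < j.+1) 'C(j.+1, i)%:R * shift i (alpha i) n.
Proof.
apply: (expands_unique (n := n.+1)
  (a := fun n => \sum_(i < j.+1) 'C(j.+1, i)%:R * shift (j - i) (eps i) n)
  (a' := fun n => \sum_(i < j.+1) 'C(j.+1, i)%:R * shift i (alpha i) n)
  (g := fun b => \sum_(i < j.+1) 'C(j.+1, i)%:R * (b%:R^-1 ^+ (j - i) * momE R d i b))) => //.
  apply: (@expands_sum R n.+1 j.+1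
    (fun i b => 'C(j.+1, i)%:R * (b%:R^-1 ^+ (j - i) * momE R d i b))
    (fun i n => 'C(j.+1, i)%:R * shift (j - i) (eps i) n)) => i _.
  apply: expandsZ; apply: (expands_trunc (leq_addr (j - i) _)).
  exact: expands_shift.
have H : expands n.+1 (fun b => \sum_(i < j.+1) 'C(j.+1, i)%:R *
    (b%:R^-1 ^+ i * momU R d i b))
    (fun n => \sum_(i < j.+1) 'C(j.+1, i)%:R * shift i (alpha i) n).
  apply: (@expands_sum R n.+1 j.+1
    (fun i b => 'C(j.+1, i)%:R * (b%:R^-1 ^+ i * momU R d i b))
    (fun i n => 'C(j.+1, i)%:R * shift i (alpha i) n)) => i _.
  apply: expandsZ; apply: (expands_trunc (leq_addr i _)).
  exact: expands_shift.
apply: expands_near H; near=> b.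
transitivity (\sum_(i < j.+1) 'C(j.+1, i)%:R * b%:R^-1 ^+ i * momU R d i b).
  by apply: eq_bigr => i _; rewrite [LHS]mulrA.
rewrite -momE_rec; last by near: b.
by apply: eq_bigr => i _; rewrite [RHS]mulrA.
Unshelve. all: by end_near. Qed.

Lemma momG_coef_rec r n :
  \sum_(j < n.+1) negbin R r j.+1 * shift j (gamma (r + j)) n =
  \sum_(j < n.+1) negbin R r j * gap R d (r.+1 + j) * shift j (alpha j) n.
Proof.
apply: (expands_unique (n := n.+1)
  (a := fun m => \sum_(j < n.+1) negbin R r j.+1 * shift j (gamma (r + j)) m)
  (a' := fun m => \sum_(j < n.+1) negbin R r j * gap R d (r.+1 + j) * shift j (alpha j) m)
  (g := fun b => \sum_(j < n.+1) negbin R r j.+1 * (b%:R^-1 ^+ j * momG R d (r + j).+2 b))) => //.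
  apply: (@expands_sum R n.+1 n.+1
    (fun j b => negbin R r j.+1 * (b%:R^-1 ^+ j * momG R d (r + j).+2 b))
    (fun j m => negbin R r j.+1 * shift j (gamma (r + j)) m)) => j _.
  apply: expandsZ; apply: (expands_trunc (leq_addr j _)).
  exact: expands_shift.
have H : expands n.+1 (fun b => \sum_(j < n.+1) negbin R r j * gap R d (r.+1 + j) *
    (b%:R^-1 ^+ j * momU R d j b))
    (fun m => \sum_(j < n.+1) negbin R r j * gap R d (r.+1 + j) * shift j (alpha j) m).
  apply: (@expands_sum R n.+1 n.+1
    (fun j b => negbin R r j * gap R d (r.+1 + j) * (b%:R^-1 ^+ j * momU R d j b))
    (fun j m => negbin R r j * gap R d (r.+1 + j) * shift j (alpha j) m)) => j _.
  apply: expandsZ; apply: (expands_trunc (leq_addr j _)).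
  exact: expands_shift.
apply: expands_bigO H _.
apply: bigOinv_near (bigOinv_db (momG_rel R d_gt0 r n.+1)); apply: nearW => b.
by congr (_ - _); apply: eq_bigr => j _; rewrite [RHS]mulrA.
Qed.

Lemma kempner_coef_sum n :
  kappa n = \sum_(j < n.+1) (-1) ^+ j * (zeta j.+2%:R - d%:R ^- j.+2) * shift j.+1 (nu j.+1) n
    - \sum_(j < n.+1) (-1) ^+ j / j.+2%:R * shift j (gamma j) n
    - \sum_(j < n.+1) (-1) ^+ j / j.+1%:R * gap R d j.+1 * shift j (alpha j.+1) n.
Proof.
pose a m := \sum_(j < n.+1) (-1) ^+ j * (zeta j.+2%:R - d%:R ^- j.+2) * shift j.+1 (nu j.+1) m
    - \sum_(j < n.+1) (-1) ^+ j / j.+2%:R * shift j (gamma j) m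
    - \sum_(j < n.+1) (-1) ^+ j / j.+1%:R * gap R d j.+1 * shift j (alpha j.+1) m.
apply: (expands_unique (n := n.+1) (kappaP n.+1) (a' := a)) => //.
have HD : expands n.+1 (fun b => \sum_(j < n.+1) (-1) ^+ j *
    (zeta j.+2%:R - d%:R ^- j.+2) * (b%:R^-1 ^+ j.+1 * momV R d j.+1 b))
    (fun m => \sum_(j < n.+1) (-1) ^+ j * (zeta j.+2%:R - d%:R ^- j.+2)
      * shift j.+1 (nu j.+1) m).
  apply: (@expands_sum R n.+1 n.+1
    (fun j b => (-1) ^+ j * (zeta j.+2%:R - d%:R ^- j.+2) * (b%:R^-1 ^+ j.+1 * momV R d j.+1 b))
    (fun j m => (-1) ^+ j * (zeta j.+2%:R - d%:R ^- j.+2) * shift j.+1 (nu j.+1) m)) => j _.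
  apply: expandsZ; apply: (expands_trunc (leq_addr j.+1 _)).
  by apply: expands_shift; exact: expands_momV.
have HA : expands n.+1 (fun b => \sum_(j < n.+1) (-1) ^+ j / j.+2%:R *
    (b%:R^-1 ^+ j * momG R d j.+2 b))
    (fun m => \sum_(j < n.+1) (-1) ^+ j / j.+2%:R * shift j (gamma j) m).
  apply: (@expands_sum R n.+1 n.+1
    (fun j b => (-1) ^+ j / j.+2%:R * (b%:R^-1 ^+ j * momG R d j.+2 b))
    (fun j m => (-1) ^+ j / j.+2%:R * shift j (gamma j) m)) => j _.
  apply: expandsZ; apply: (expands_trunc (leq_addr j _)).
  exact: expands_shift.
have HB : expands n.+1 (fun b => \sum_(j < n.+1) (-1) ^+ j / j.+1%:R * gap R d j.+1 *
    (b%:R^-1 ^+ j * momU R d j.+1 b))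
    (fun m => \sum_(j < n.+1) (-1) ^+ j / j.+1%:R * gap R d j.+1 * shift j (alpha j.+1) m).
  apply: (@expands_sum R n.+1 n.+1
    (fun j b => (-1) ^+ j / j.+1%:R * gap R d j.+1 * (b%:R^-1 ^+ j * momU R d j.+1 b))
    (fun j m => (-1) ^+ j / j.+1%:R * gap R d j.+1 * shift j (alpha j.+1) m)) => j _.
  apply: expandsZ; apply: (expands_trunc (leq_addr j _)).
  exact: expands_shift.
apply: expands_bigO (expandsB (expandsB HD HA) HB) _.
apply: bigOinv_near (bigOinv_db (kempner_rel R d_gt0 n.+1)); apply: nearW => b.
set SG := \sum_(j < n.+1) _; set SU := \sum_(j < n.+1) _; set SV := \sum_(j < n.+1) _.
set SV' := \sum_(j < n.+1) _; set SG' := \sum_(j < n.+1) _; set SU' := \sum_(j < n.+1) _.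
have -> : SG = SG' by rewrite /SG /SG'; apply: eq_bigr => j _; rewrite [RHS]mulrA.
have -> : SU = SU' by rewrite /SU /SU'; apply: eq_bigr => j _; rewrite [RHS]mulrA.
have -> : SV = SV' by rewrite /SV /SV'; apply: eq_bigr => j _; rewrite [RHS]mulrA.
by ring.
Qed.

End coefficients.

(** * Explicit first coefficients *)

Section explicit.
Variables (R : realType) (D : R).
(* From here on only the linear equations between the coefficients matter: D
   stands for d, gp s for the gap of order s, and zd j for zeta(j+2) - d^(-j-2). *)
Variables (alpha eps gamma : nat -> nat -> R) (kappa : nat -> R) (gp zd : nat -> R).
Local Notation nu := (shifted_moment D alpha).
Hypothesis alpha0 : forall n, alpha 0 n = 1 *+ (n == 0)%N.
Hypothesis alphaS : forall j n, alpha j.+1 n = eps j.+1 n - shift j.+2 (nu j.+1) n.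
Hypothesis eps_rec : forall j n,
  \sum_(i < j.+1) 'C(j.+1, i)%:R * shift (j - i) (eps i) n =
  \sum_(i < j.+1) 'C(j.+1, i)%:R * shift i (alpha i) n.
Hypothesis gamma_rec : forall r n,
  \sum_(j < n.+1) negbin R r j.+1 * shift j (gamma (r + j)) n =
  \sum_(j < n.+1) negbin R r j * gp (r.+1 + j)%N * shift j (alpha j) n.
Hypothesis kappa_sum : forall n,
  kappa n = \sum_(j < n.+1) (-1) ^+ j * zd j * shift j.+1 (nu j.+1) n
    - \sum_(j < n.+1) (-1) ^+ j / j.+2%:R * shift j (gamma j) n
    - \sum_(j < n.+1) (-1) ^+ j / j.+1%:R * gp j.+1 * shift j (alpha j.+1) n.

(** The coefficients of E_j are eliminated, so that only those of U_j remain. *)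
Let epsS j n : eps j.+1 n = alpha j.+1 n + shift j.+2 (nu j.+1) n.
Proof. by rewrite alphaS subrK. Qed.

Let eps0 n : eps 0 n = alpha 0 n.
Proof.
by have := eps_rec 0 n; rewrite !big_ord1 bin0 !mul1r /shift ltn0 !subn0.
Qed.

(* Expansion of the relations at numerical indices: big sums are unrolled and
   shifts, binomial coefficients and sums of indices are evaluated. *)
Ltac unroll := rewrite !big_ord_recr !big_ord0 /= ?add0r.

Ltac eval_shift := repeat match goal with
  | |- context [@shift ?R ?k ?a ?n] =>
      let v := eval compute in (n < k)%N in
      match v with
      | true => change (@shift R k a n) with (0 : R)
      | false => let m := eval compute in (n - k)%N in
                 change (@shift R k a n) with (a m)
      end
  end.

Ltac eval_nat := repeat match goal with
  | |- context [binomial ?n ?k] =>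
      let v := eval compute in (binomial n k) in
      change (binomial n k) with v
  | |- context [addn ?m ?n] =>
      let v := eval compute in (addn m n) in change (addn m n) with v
  end.

Ltac expand_nu := rewrite /shifted_moment; do ?unroll; eval_nat.

Ltac expand_eps := unroll; eval_shift; rewrite ?epsS ?eps0; eval_shift;
  expand_nu; rewrite ?alpha0 /=.

Ltac expand_all := rewrite /negbin; unroll; eval_shift; expand_nu; rewrite ?alpha0 /=.

Ltac alpha_value known :=
  match goal with |- alpha ?j ?n = _ => move: (eps_rec j n) end;
  expand_eps; rewrite ?known; lra.

(** The coefficients alpha_j(n) with j >= 1 and j + n <= 6, grouped by n;
    those of order n depend on lower orders only. *)
Let order0 :
  ((alpha 1 0 = 1 / 2) *
   (alpha 2 0 = 1 / 3) *
   (alpha 3 0 = 1 / 4) *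
   (alpha 4 0 = 1 / 5) *
   (alpha 5 0 = 1 / 6) *
   (alpha 6 0 = 1 / 7))%type.
Proof. by do ![split]; alpha_value alpha0. Qed.

Let order1 :
  ((alpha 1 1 = 0) *
   (alpha 2 1 = 0) *
   (alpha 3 1 = 0) *
   (alpha 4 1 = 0) *
   (alpha 5 1 = 0))%type.
Proof. by do ![split]; alpha_value order0. Qed.

Let order2 :
  ((alpha 1 2 = - 1 / 2 - D) *
   (alpha 2 2 = 0) *
   (alpha 3 2 = 0) *
   (alpha 4 2 = 0))%type.
Proof. by do ![split]; alpha_value (order0, order1). Qed.

Let order3 :
  ((alpha 1 3 = - 1 / 2 - D) *
   (alpha 2 3 = - 5 / 6 - 2 * D - D ^+ 2) *
   (alpha 3 3 = - 1 / 2 - D))%type.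
Proof. by do ![split]; alpha_value (order0, order1, order2). Qed.

Let order4 :
  ((alpha 1 4 = 0) *
   (alpha 2 4 = 0))%type.
Proof. by do ![split]; alpha_value (order0, order1, order2, order3). Qed.

Let order5 : alpha 1 5 = 1 / 2 + D.
Proof. by alpha_value (order0, order1, order2, order3, order4). Qed.

Let orders := (order0, order1, order2, order3, order4, order5).

(** In the following values the unknowns gamma_j(n-j) are eliminated between
    [kappa_sum] and the relations [gamma_rec] for r = 0, 1, 3, 5, taken in the
    proportions -1/2, -1/12, 1/120, -1/252. These are the coefficients of the
    inverse powers in the Stirling expansion of the digamma function; they
    vanish for r = 2, 4. *)
Lemma kappa_val0 : kappa 0 =
  0.
Proof.
move: (kappa_sum 0) (gamma_rec 0 0).
by expand_all; rewrite ?orders; lra.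
Qed.

Lemma kappa_val1 : kappa 1 =
  (1 / 2 + D) * zd 0.
Proof.
move: (kappa_sum 1) (gamma_rec 0 1) (gamma_rec 1 0).
by expand_all; rewrite ?orders; lra.
Qed.

Lemma kappa_val2 : kappa 2 =
  (- 1 / 3 - D - D ^+ 2) * zd 1
  + (1 / 2 + D) * gp 1.
Proof.
move: (kappa_sum 2) (gamma_rec 0 2) (gamma_rec 1 1).
by expand_all; rewrite ?orders; lra.
Qed.

Lemma kappa_val3 : kappa 3 =
  (- 1 / 2 - D) * zd 0
  + (1 / 4 + D + 3 / 2 * D ^+ 2 + D ^+ 3) * zd 2
  + (1 / 2 + D) * gp 1
  + (1 / 4 + 1 / 2 * D) * gp 2.
Proof.
move: (kappa_sum 3) (gamma_rec 0 3) (gamma_rec 1 2) (gamma_rec 3 0).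
by expand_all; rewrite ?orders; lra.
Qed.

Lemma kappa_val4 : kappa 4 =
  (- 1 / 2 - D) * zd 0
  + (D + 2 * D ^+ 2) * zd 1
  + (- 1 / 5 - D - 2 * D ^+ 2 - 2 * D ^+ 3 - D ^+ 4) * zd 3
  + (- 1 / 6 - 1 / 2 * D - 1 / 2 * D ^+ 2) * gp 2
  + (1 / 12 + 1 / 6 * D) * gp 3.
Proof.
move: (kappa_sum 4) (gamma_rec 0 4) (gamma_rec 1 3) (gamma_rec 3 1).
by expand_all; rewrite ?orders; lra.
Qed.

Lemma kappa_val5 : kappa 5 =
  (5 / 6 + 3 * D + 3 * D ^+ 2) * zd 1
  + (- 3 / 2 * D ^+ 2 - 3 * D ^+ 3) * zd 2
  + (1 / 6 + D + 5 / 2 * D ^+ 2 + 10 / 3 * D ^+ 3 + 5 / 2 * D ^+ 4 + D ^+ 5) * zd 4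
  + (- 1 / 2 - D) * gp 1
  + (- 1 / 6 - 1 / 2 * D - 1 / 2 * D ^+ 2) * gp 3.
Proof.
move: (kappa_sum 5) (gamma_rec 0 5) (gamma_rec 1 4) (gamma_rec 3 2) (gamma_rec 5 0).
by expand_all; rewrite ?orders; lra.
Qed.

End explicit.

(** * The asymptotic expansion *)

Lemma bigOinv_eqaddO (R : realType) (f g : nat -> R) n :
  bigOinv n (fun b => f b - g b) -> f = g +O_\oo (fun b : nat => b%:R ^- n : R).
Proof.
move=> [C HC]; apply/eqaddOP; exists C; split; first exact: num_real.
move=> K CK; near=> b.
have : `|f b - g b| <= C * b%:R^-1 ^+ n by near: b.
rewrite exprVn => /le_trans; apply.
by rewrite (@ger0_norm _ (b%:R ^- n)) ?invr_ge0 ?exprn_ge0// ler_wpM2r ?invr_ge0 ?exprn_ge0// ltW.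
Unshelve. all: by end_near. Qed.
(** The first coefficients of any expansion of the corrected Kempner sum. *)
Lemma kempner_corr_coefs (R : realType) (d : nat) (kappa : nat -> R) : (0 < d)%N ->
  (forall n, expands n (kempner_corr R d) kappa) ->
  [/\ kappa 0 = 0, kappa 1 = kempner_coef1 d%:R, kappa 2 = kempner_coef2 d%:R &
    [/\ kappa 3 = kempner_coef3 d%:R, kappa 4 = kempner_coef4 d%:R &
     kappa 5 = kempner_coef5 d%:R]].
Proof.
move=> d_gt0 kappaP.
have [alpha alphaP] := choice (fun j => full_expansion (has_expansion_momU R d ^~ j)).
have [eps epsP] := choice (fun j => full_expansion (has_expansion_momE R d ^~ j)).
have [gamma gammaP] := choice (fun r => full_expansion (has_expansion_momG R d_gt0 ^~ r)).
have h1 := momU_coef0 alphaP.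
have h2 := momU_coefS alphaP epsP.
have h3 := momE_coef_rec alphaP epsP.
have h4 := momG_coef_rec d_gt0 alphaP gammaP.
have h5 := kempner_coef_sum d_gt0 alphaP gammaP kappaP.
have d0 : d%:R != 0 :> R by rewrite pnatr_eq0 -lt0n.
have d1 : d%:R + 1 != 0 :> R by rewrite natr1 pnatr_eq0.
(* The zeta value at j + 2, with the term d^(-j-2) of its series removed. *)
pose zd j : R := zeta j.+2%:R - d%:R ^- j.+2.
have K0 := kappa_val0 (gp := gap R d) (zd := zd) h1 h2 h3 h4 h5.
have K1 := kappa_val1 (gp := gap R d) (zd := zd) h1 h2 h3 h4 h5.
have K2 := kappa_val2 (gp := gap R d) (zd := zd) h1 h2 h3 h4 h5.
have K3 := kappa_val3 (gp := gap R d) (zd := zd) h1 h2 h3 h4 h5.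
have K4 := kappa_val4 (gp := gap R d) (zd := zd) h1 h2 h3 h4 h5.
have K5 := kappa_val5 (gp := gap R d) (zd := zd) h1 h2 h3 h4 h5.
split=> //; last split.
- rewrite K1 /kempner_coef1 /zd /gap; clear -d0 d1; move: (d%:R : R) d0 d1 => D d0 d1.
  by field; rewrite ?d0 ?d1.
- rewrite K2 /kempner_coef2 /zd /gap; clear -d0 d1; move: (d%:R : R) d0 d1 => D d0 d1.
  by field; rewrite ?d0 ?d1.
- rewrite K3 /kempner_coef3 /zd /gap; clear -d0 d1; move: (d%:R : R) d0 d1 => D d0 d1.
  by field; rewrite ?d0 ?d1.
- rewrite K4 /kempner_coef4 /zd /gap; clear -d0 d1; move: (d%:R : R) d0 d1 => D d0 d1.
  by field; rewrite ?d0 ?d1.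
- rewrite K5 /kempner_coef5 /zd /gap; clear -d0 d1; move: (d%:R : R) d0 d1 => D d0 d1.
  by field; rewrite ?d0 ?d1.
Qed.

Theorem proposition9 (R : realType) (d : nat) (d_gt0 : (0 < d)%N) :
  has_asymptotic_expansion
    (fun b : nat => kempner R b d
       - (b%:R * ln b%:R - b%:R * ln (1 + d%:R^-1)))
  /\
  (fun b : nat => kempner R b d) =
    (fun b : nat => b%:R * ln b%:R - b%:R * ln (1 + d%:R^-1)
       + kempner_coef1 d%:R / b%:R
       + kempner_coef2 d%:R / b%:R ^+ 2
       + kempner_coef3 d%:R / b%:R ^+ 3
       + kempner_coef4 d%:R / b%:R ^+ 4
       + kempner_coef5 d%:R / b%:R ^+ 5)
    +O_\oo (fun b : nat => b%:R ^- 6 : R).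
Proof.
have [kappa kappaP] := full_expansion (has_expansion_kempner_corr R d_gt0).
split.
  exists kappa => N; apply: bigOinv_eqaddO.
  apply: bigOinv_near (kappaP N.+1); apply: nearW => b.
  rewrite /kempner_corr; congr (_ - _); rewrite big_mkord.
  by apply: eq_bigr => i _; rewrite exprVn.
have [k0 k1 k2 [k3 k4 k5]] := kempner_corr_coefs d_gt0 kappaP.
apply: bigOinv_eqaddO; apply: bigOinv_near (kappaP 6%N); apply: nearW => b.
rewrite /kempner_corr !big_ord_recr big_ord0 /= k0 k1 k2 k3 k4 k5 !exprVn expr1.
by ring.
Qed.
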